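(* Let $n\ge1$ be an integer and $\nu\in\mathbb R$. The quantities $X=X(\nu,n,a)$ and $Y=Y(\nu,n,a)$, $0<a<1$, defined in the context are related to the functions $\mu_\nu$ and $\mu_{\nu+1}$ (also defined there) by the equations $$\mu_\nu=\frac{2na}{1-a^2}\,\frac{X+aY}{1+aXY},\qquad \mu_{\nu+1}=\frac{2na}{1-a^2}\,\frac{aX+Y}{1+aXY}.$$ They obey the following non-linear differential system: $$a\frac{d}{da}X=\nu X-(1-X^2)\frac{2na}{1-a^2}\,\frac{aX+Y}{1+aXY},$$ $$a\frac{d}{da}Y=-(\nu+1)Y+(1-Y^2)\frac{2na}{1-a^2}\,\frac{X+aY}{1+aXY}.$$
   Context: Fix an integer $n\ge1$; $x>0$, $a=e^{-x}\in(0,1)$, and functions of $x$ are viewed as functions of $a$ (so $a\frac{d}{da}=-\frac{d}{dx}$). The expression $\frac{\sinh(sx)}{s}$ is given the value $x$ at $s=0$. For real $\lambda$ put $\kappa_j^\lambda=\frac{\lambda+1}2+j-1$, $1\le j\le n$. Let $E_\lambda,F_\lambda$ be the entire functions and $c_j^\lambda,d_j^\lambda$ the real coefficients (functions of $a$, depending also on $n$) such that for all $t\in\mathbb C$ $$E_\lambda(it)=e^{xt}+\sum_{1\le j\le n}c_j^\lambda\frac{2\sinh((t-\kappa_j^\lambda)x)}{t-\kappa_j^\lambda},\qquad F_\lambda(it)=(-1)^ne^{-xt}+\sum_{1\le j\le n}d_j^\lambda\frac{2\sinh((t-\kappa_j^\lambda)x)}{t-\kappa_j^\lambda},$$ the coefficients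 being determined uniquely by $E_\lambda(-i\kappa_i^\lambda)=F_\lambda(-i\kappa_i^\lambda)=0$ for $1\le i\le n$. The function $\mu_\lambda$ is the coefficient of the differential system, for all $t$, $$\frac{d}{dx}E_\lambda(it)=tE_\lambda(it)+\mu_\lambda F_\lambda(it),\qquad \frac{d}{dx}F_\lambda(it)=-tF_\lambda(it)+\mu_\lambda E_\lambda(it);$$ explicitly $\mu_\lambda=(-1)^n\sum_{1\le j\le n}2c_j^\lambda e^{\kappa_j^\lambda x}$. Put $$e_\nu=E_\nu(-i\tfrac{\nu+1}2-in),\quad f_\nu=F_\nu(-i\tfrac{\nu+1}2-in),\quad g_{\nu+1}=E_{\nu+1}(-i\tfrac\nu2),\quad h_{\nu+1}=F_{\nu+1}(-i\tfrac\nu2).$$ The quantities $e_\nu,f_\nu,g_{\nu+1},h_{\nu+1},c_1^\nu,d_1^\nu,c_n^{\nu+1},d_n^{\nu+1}$ never vanish, and one defines (the two expressions given for each of $X$, $Y$ being equal) $$X=\frac{g_{\nu+1}}{h_{\nu+1}}=\frac1a\,\frac{e_\nu}{f_\nu},\qquad Y=-\frac1a\,\frac{c_n^{\nu+1}}{d_n^{\nu+1}}=-\frac{c_1^\nu}{d_1^\nu}.$$ *)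

(* Defs.v *)
From Stdlib Require Import Reals ClassicalEpsilon.
From Coquelicot Require Import Coquelicot.

Open Scope R_scope.

Definition Cexp (z : C) : C :=
  (exp (Re z) * cos (Im z), exp (Re z) * sin (Im z)).

Definition Csinh (z : C) : C := ((Cexp z - Cexp (- z)) / 2)%C.

Definition sinh_quot (s : C) (x : R) : C :=
  if Ceq_dec s 0 then RtoC x else (Csinh (s * x) / s)%C.

Definition kappa (lam : R) (j : nat) : R := (lam + 1) / 2 + INR j - 1.

Definition kernel_sum (n : nat) (lam x : R) (c : nat -> R) (t : C) : C :=
  sum_n_m (fun j : nat => (c j * (2 * sinh_quot (t - kappa lam j) x))%C) 1 n.

(* Functions of z = i t, hence t = - i z. *)
Definition E_form (n : nat) (lam x : R) (c : nat -> R) (z : C) : C :=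
  let t : C := (- Ci * z)%C in
  (Cexp (x * t) + kernel_sum n lam x c t)%C.

Definition F_form (n : nat) (lam x : R) (d : nat -> R) (z : C) : C :=
  let t : C := (- Ci * z)%C in
  (RtoC ((-1) ^ n) * Cexp (- (x * t)) + kernel_sum n lam x d t)%C.

Definition trivial_zeros (n : nat) (lam : R) (G : C -> C) : Prop :=
  forall i : nat, (1 <= i <= n)%nat -> G (- Ci * kappa lam i)%C = 0%C.

(* The real coefficients c_j and d_j are pinned down by the zeros only for
   1 <= j <= n; the values at other indices are irrelevant. *)
Definition c_coef (n : nat) (lam x : R) : nat -> R :=
  epsilon (inhabits (fun _ : nat => 0))
    (fun c : nat -> R => trivial_zeros n lam (E_form n lam x c)).

Definition d_coef (n : nat) (lam x : R) : nat -> R :=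
  epsilon (inhabits (fun _ : nat => 0))
    (fun d : nat -> R => trivial_zeros n lam (F_form n lam x d)).

Definition E_fun (n : nat) (lam x : R) (z : C) : C :=
  E_form n lam x (c_coef n lam x) z.

Definition F_fun (n : nat) (lam x : R) (z : C) : C :=
  F_form n lam x (d_coef n lam x) z.

Definition diff_system (n : nat) (lam : R) (m : R -> R) : Prop :=
  forall (x : R) (t : C), 0 < x ->
    is_derive (K := R_AbsRing) (V := C_R_NormedModule)
      (fun y : R => E_fun n lam y (Ci * t)%C) x
      (t * E_fun n lam x (Ci * t) + m x * F_fun n lam x (Ci * t))%C /\
    is_derive (K := R_AbsRing) (V := C_R_NormedModule)
      (fun y : R => F_fun n lam y (Ci * t)%C) x
      (- t * F_fun n lam x (Ci * t) + m x * E_fun n lam x (Ci * t))%C.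

(* The coefficient of the differential system, as a function of x > 0; the
   system determines it uniquely, with value
   (-1)^n * sum_(1 <= j <= n) 2 * c_j * exp (kappa_j * x). *)
Definition mu_x (n : nat) (lam : R) : R -> R :=
  epsilon (inhabits (fun _ : R => 0)) (diff_system n lam).

(* From here on, functions of a = exp (- x), that is x = - ln a. *)
Definition mu (n : nat) (lam a : R) : R := mu_x n lam (- ln a).

(* E and F are real at purely imaginary points, so Re loses nothing;
   g and h stand for g_{nu+1} and h_{nu+1}. *)
Definition g (n : nat) (nu a : R) : R :=
  Re (E_fun n (nu + 1) (- ln a) (- Ci * RtoC (nu / 2))%C).

Definition h (n : nat) (nu a : R) : R :=
  Re (F_fun n (nu + 1) (- ln a) (- Ci * RtoC (nu / 2))%C).

(* X also equals E_nu / (a * F_nu) at z = - i (nu + 1) / 2 - i n, and Y also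
   equals - c_n / (a * d_n) formed at nu + 1; h and d_1 never vanish. *)
Definition X (n : nat) (nu a : R) : R := g n nu a / h n nu a.

Definition Y (n : nat) (nu a : R) : R :=
  - (c_coef n nu (- ln a) 1%nat / d_coef n nu (- ln a) 1%nat).

(* Main.v *)
Require Import Defs.
From Stdlib Require Import Reals Lra ClassicalEpsilon ssreflect.
From Coquelicot Require Import Coquelicot.
Set Implicit Arguments.
Unset Strict Implicit.
Unset Printing Implicit Defensive.
Open Scope R_scope.

(** Put a = e^-x and b = e^x, and let L_lam(p) be the integral of p(u) u^lam over
    [a, b], a positive functional on real polynomials.  The numbers
    2 sinh((t - kappa_j) x)/(t - kappa_j) at real t are moments of such weights, so
    the conditions E = 0 and F = 0 at -i kappa_i say that the polynomials with
    coefficients c_j and d_j are, up to explicit factors, the reproducing kernels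
    K(u, a) and K(u, b) of L_lam on polynomials of degree less than n (c_coefE,
    d_coefE).

    Derivatives.  Differentiating the reproducing identity in x and integrating by
    parts shows that the derivative of either kernel is an Euler operator applied to
    it plus a multiple of the other kernel (is_derive_kern).  This is the
    differential system, with mu_lam = -2 (-1)^n K(a, b), and it pins mu_lam down
    because F does not vanish identically (mu_x_pairing).  Both X = g/h and
    -Y = c_1/d_1 are quotients of two functions linked by a linear system of this
    kind, so they satisfy Riccati equations whose coefficients are mu_(nu+1) and
    mu_nu (is_derive_quotient_riccati).

    Elimination of mu.  Let P be the orthogonal polynomial of degree n for u^nu with
    P(0) = 1, and Q(u) = K(u, 0), which is orthogonal for u^(nu+1).  Then X is
    (-1)^n a^nu P(a)/P(b) and Y is -(-1)^n a^(nu+1) Q(a)/Q(b) (endpoint_values).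
    Two Christoffel-Darboux formulas express K(a, b) at nu and at nu + 1 through
    these four values (christoffel_darboux, christoffel_darboux_shift), and one
    integration by parts gives

        b^(nu+1) P(b) Q(b) - a^(nu+1) P(a) Q(a) = -n

    (boundary_pairing), whose left side is b^(nu+1) P(b) Q(b) (1 + a X Y).  So the
    denominator 1 + a X Y never vanishes, and the formulas for mu_nu and mu_(nu+1)
    become rational identities (mu_from_XY).  P and Q have no zero at a or b by
    positivity (ortho_horner_exp_neq0). *)

(** * Complex-valued functions of a real variable *)

Notation is_deriveC := (@is_derive R_AbsRing C_R_NormedModule).

Lemma is_deriveC_pair (f : R -> C) (x : R) (l : C) :
  is_derive (fun y => Re (f y)) x (Re l) -> is_derive (fun y => Im (f y)) x (Im l) ->
  is_deriveC f x l.
Proof.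
move=> df1 df2.
have d1 := @is_derive_scal_l R_AbsRing C_R_NormedModule _ x _ (RtoC 1) df1.
have d2 := @is_derive_scal_l R_AbsRing C_R_NormedModule _ x _ Ci df2.
have d := is_derive_plus _ _ _ _ _ d1 d2.
have E (z : C) : plus (@scal _ C_R_NormedModule (Re z) (RtoC 1))
    (@scal _ C_R_NormedModule (Im z) Ci) = z.
  case: z => u v; apply: injective_projections;
    rewrite /plus /scal /= /prod_plus /prod_scal /scal /mult /plus /= /mult /=; ring.
rewrite -(E l); apply: is_derive_ext d => y; exact: E.
Qed.

Lemma is_derive_ReC (f : R -> C) (x : R) (l : C) :
  is_deriveC f x l -> is_derive (fun y => Re (f y)) x (Re l).
Proof.
move=> df.
exact: (@filterdiff_comp' R_AbsRing _ C_R_NormedModule R_NormedModule f (fun z => fst z) x _ _ df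
  (filterdiff_linear _ (@is_linear_fst R_AbsRing R_NormedModule R_NormedModule))).
Qed.

Lemma is_derive_ImC (f : R -> C) (x : R) (l : C) :
  is_deriveC f x l -> is_derive (fun y => Im (f y)) x (Im l).
Proof.
move=> df.
exact: (@filterdiff_comp' R_AbsRing _ C_R_NormedModule R_NormedModule f (fun z => snd z) x _ _ df
  (filterdiff_linear _ (@is_linear_snd R_AbsRing R_NormedModule R_NormedModule))).
Qed.

Lemma is_deriveC_unique (f : R -> C) (x : R) (l1 l2 : C) :
  is_deriveC f x l1 -> is_deriveC f x l2 -> l1 = l2.
Proof.
move=> d1 d2; apply: injective_projections.
  change (Re l1 = Re l2); rewrite -(is_derive_unique _ _ _ (is_derive_ReC d1)).
  exact: is_derive_unique (is_derive_ReC d2).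
change (Im l1 = Im l2); rewrite -(is_derive_unique _ _ _ (is_derive_ImC d1)).
exact: is_derive_unique (is_derive_ImC d2).
Qed.

Lemma is_deriveC_eq (f : R -> C) (x : R) (l1 l2 : C) :
  is_deriveC f x l1 -> l1 = l2 -> is_deriveC f x l2.
Proof. by move=> d <-. Qed.

Lemma is_deriveC_ext (f g : R -> C) (x : R) (l : C) :
  (forall y : R, f y = g y) -> is_deriveC f x l -> is_deriveC g x l.
Proof. exact: is_derive_ext. Qed.

Lemma is_deriveC_plus (f g : R -> C) (x : R) (a b : C) :
  is_deriveC f x a -> is_deriveC g x b ->
  is_deriveC (fun y => f y + g y)%C x (a + b)%C.
Proof. exact: is_derive_plus. Qed.

Lemma is_deriveC_const (z : C) (x : R) : is_deriveC (fun _ => z) x (RtoC 0).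
Proof. exact: is_derive_const. Qed.

Lemma is_deriveC_RtoC (f : R -> R) (x l : R) :
  is_derive f x l -> is_deriveC (fun y => RtoC (f y)) x (RtoC l).
Proof. by move=> df; apply: is_deriveC_pair => //=; apply: is_derive_const. Qed.

Lemma is_deriveC_mult (f g : R -> C) (x : R) (a b : C) :
  is_deriveC f x a -> is_deriveC g x b ->
  is_deriveC (fun y => f y * g y)%C x (a * g x + f x * b)%C.
Proof.
have M (u v : R -> R) (p q : R) : is_derive u x p -> is_derive v x q ->
    is_derive (fun y => u y * v y) x (p * v x + u x * q).
  by move=> du dv; apply: is_derive_mult => // *; apply: Rmult_comm.
move=> df dg.
have f1 := is_derive_ReC df; have f2 := is_derive_ImC df.
have g1 := is_derive_ReC dg; have g2 := is_derive_ImC dg.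
apply: is_deriveC_pair => /=.
- have := is_derive_minus _ _ _ _ _ (M _ _ _ _ f1 g1) (M _ _ _ _ f2 g2).
  congr is_derive; rewrite /minus /plus /opp /= /Re /Im; ring.
- have := is_derive_plus _ _ _ _ _ (M _ _ _ _ f1 g2) (M _ _ _ _ f2 g1).
  congr is_derive; rewrite /plus /= /Re /Im; ring.
Qed.

Lemma is_deriveC_exp (t : C) (x : R) :
  is_deriveC (fun y => Cexp (y * t)) x (t * Cexp (x * t))%C.
Proof.
by case: t => p q; apply: is_deriveC_pair; rewrite /Cexp /= /Rminus; auto_derive => //; ring.
Qed.

Lemma Cexp_plus (z w : C) : Cexp (z + w) = (Cexp z * Cexp w)%C.
Proof.
case: z => a b; case: w => c d; apply: injective_projections;
  rewrite /Cexp /= exp_plus ?cos_plus ?sin_plus; ring.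
Qed.

Lemma Cexp_RtoC (u : R) : Cexp (RtoC u) = RtoC (exp u).
Proof. by rewrite /Cexp /= cos_0 sin_0 Rmult_1_r Rmult_0_r. Qed.

(** Multiplication by s absorbs the case distinction at s = 0. *)
Lemma mul_sinh_quot (s : C) (x : R) :
  (s * (2 * sinh_quot s x) = Cexp (x * s) - Cexp (- (x * s)))%C.
Proof.
rewrite /sinh_quot; case: Ceq_dec => [->|s0].
  have -> : (x * 0 = RtoC 0)%C by ring.
  have -> : (- RtoC 0 = RtoC 0)%C by ring.
  by ring.
rewrite /Csinh (Cmult_comm s x); field; exact: s0.
Qed.

Lemma is_deriveC_sinh_quot (s : C) (x : R) :
  is_deriveC (fun y => 2 * sinh_quot s y)%C x (Cexp (x * s) + Cexp (- (x * s)))%C.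
Proof.
rewrite /sinh_quot; case: Ceq_dec => [->|s0].
  have -> : (x * 0 = RtoC 0)%C by ring.
  have -> : (- RtoC 0 = RtoC 0)%C by ring.
  apply: is_deriveC_eq.
    apply: is_deriveC_mult; first exact: is_deriveC_const.
    apply: is_deriveC_RtoC; exact: is_derive_id.
  rewrite Cexp_RtoC exp_0; have -> : one = 1 by []. ring.
apply: (@is_deriveC_ext (fun y => / s * (Cexp (y * s) + (- (1)) * Cexp (y * - s)))%C) => [y|].
  rewrite /Csinh (Cmult_comm s y); have -> : (y * - s = - (y * s))%C by ring.
  field; exact: s0.
apply: is_deriveC_eq.
  apply: is_deriveC_mult; first exact: is_deriveC_const.
  apply: is_deriveC_plus; first exact: is_deriveC_exp.
  apply: is_deriveC_mult; first exact: is_deriveC_const.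
  exact: is_deriveC_exp.
have -> : (x * - s = - (x * s))%C by ring.
field; exact: s0.
Qed.

Notation sum_C f n := (@sum_n_m C_AbelianMonoid f 1 n).

Lemma is_deriveC_sum_n_m (f : nat -> R -> C) (l : nat -> C) (x : R) (n : nat) :
  (forall j, (1 <= j <= n)%nat -> is_deriveC (f j) x (l j)) ->
  is_deriveC (fun y => sum_C (fun j => f j y) n) x (sum_C l n).
Proof.
elim: n => [|n IHn] df.
  rewrite sum_n_m_zero; last by auto.
  apply: (@is_deriveC_ext (fun _ => zero)); last exact: is_derive_const.
  by move=> y; rewrite sum_n_m_zero; auto.
have n1 : (1 <= S n)%nat by apply: le_n_S; apply: Nat.le_0_l.
rewrite sum_n_Sm //.
apply: (@is_derive_ext R_AbsRing C_R_NormedModule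
  (fun y => @sum_n_m C_AbelianMonoid (fun j => f j y) 1 n + f (S n) y)%C).
  by move=> y; rewrite sum_n_Sm.
apply: is_deriveC_plus; last by apply: df; split.
apply: IHn => j [j1 jn]; apply: df; split=> //; exact: Nat.le_trans jn (Nat.le_succ_diag_r n).
Qed.

Lemma sum_C_ext (f g : nat -> C) (n : nat) :
  (forall j, (1 <= j <= n)%nat -> f j = g j) -> sum_C f n = sum_C g n.
Proof. exact: sum_n_m_ext_loc. Qed.

Lemma sum_C_plus (f g : nat -> C) (n : nat) :
  sum_C (fun j => f j + g j)%C n = (sum_C f n + sum_C g n)%C.
Proof. exact: sum_n_m_plus. Qed.

Lemma sum_C_mult (z : C) (f : nat -> C) (n : nat) :
  sum_C (fun j => z * f j)%C n = (z * sum_C f n)%C.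
Proof. exact: (@sum_n_m_mult_l C_Ring). Qed.

Lemma sum_C_RtoC (f : nat -> R) (n : nat) :
  sum_C (fun j => RtoC (f j)) n = RtoC (sum_n_m f 1 n).
Proof.
elim: n => [|n IHn]; first by rewrite !sum_n_m_zero; auto.
have n1 : (1 <= S n)%nat by apply: le_n_S; apply: Nat.le_0_l.
by rewrite !sum_n_Sm // IHn [RHS]RtoC_plus.
Qed.

Lemma kernel_sum_ext (n : nat) (lam x : R) (c d : nat -> R) (t : C) :
  (forall j, (1 <= j <= n)%nat -> c j = d j) ->
  kernel_sum n lam x c t = kernel_sum n lam x d t.
Proof. by move=> cd; apply: sum_C_ext => j jn; rewrite cd. Qed.

Lemma is_deriveC_kernel_sum (n : nat) (lam : R) (c : R -> nat -> R) (c' : nat -> R)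
    (x : R) (t : C) :
  (forall j, (1 <= j <= n)%nat -> is_derive (fun y => c y j) x (c' j)) ->
  is_deriveC (fun y => kernel_sum n lam y (c y) t) x
    (sum_C (fun j => c' j * (2 * sinh_quot (t - kappa lam j) x) +
       c x j * (Cexp (x * (t - kappa lam j)) + Cexp (- (x * (t - kappa lam j)))))%C n).
Proof.
move=> dc; apply: is_deriveC_sum_n_m => j jn.
apply: is_deriveC_mult; first exact/is_deriveC_RtoC/dc.
exact: is_deriveC_sinh_quot.
Qed.

Lemma mul_NCi_Ci (t : C) : (- Ci * (Ci * t) = t)%C.
Proof. by apply: injective_projections; rewrite /=; ring. Qed.

(** With s = t - kappa_j, the kernel 2 sinh(s x)/s has derivative e^(sx) + e^(-sx)
    in x, and s times it is e^(sx) - e^(-sx).  In the derivative of E minus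
    t E + m F the terms in e^(sx) therefore cancel, and the rest is e^(-tx) times
    the difference of the two sides of the second hypothesis. *)
Lemma is_deriveC_E_form (n : nat) (lam : R) (c : R -> nat -> R) (d : nat -> R) (m x : R) (t : C) :
  (forall j, (1 <= j <= n)%nat ->
     is_derive (fun y => c y j) x (kappa lam j * c x j + m * d j)) ->
  sum_n_m (fun j => 2 * (c x j * exp (kappa lam j * x))) 1 n = m * (-1) ^ n ->
  is_deriveC (fun y => E_form n lam y (c y) (Ci * t)%C) x
    (t * E_form n lam x (c x) (Ci * t) + m * F_form n lam x d (Ci * t))%C.
Proof.
move=> dc mE; rewrite /E_form /F_form mul_NCi_Ci.
apply: is_deriveC_eq.
  apply: is_deriveC_plus; first exact: is_deriveC_exp.
  exact: is_deriveC_kernel_sum dc.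
have -> : sum_C (fun j => (kappa lam j * c x j + m * d j)%R * (2 * sinh_quot (t - kappa lam j) x) +
       c x j * (Cexp (x * (t - kappa lam j)) + Cexp (- (x * (t - kappa lam j)))))%C n =
   (t * kernel_sum n lam x (c x) t + m * kernel_sum n lam x d t +
    Cexp (- (x * t)) * sum_n_m (fun j => (2 * (c x j * exp (kappa lam j * x)))%R) 1 n)%C.
  rewrite -sum_C_RtoC /kernel_sum -!sum_C_mult -!sum_C_plus; apply: sum_C_ext => j _.
  have -> : RtoC (2 * (c x j * exp (kappa lam j * x))) = (2 * (c x j * Cexp (x * kappa lam j)))%C.
    by rewrite -RtoC_mult Cexp_RtoC [(x * _)%R]Rmult_comm !RtoC_mult.
  have eN : Cexp (- (x * (t - kappa lam j))) = (Cexp (- (x * t)) * Cexp (x * kappa lam j))%C.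
    by rewrite -Cexp_plus; congr Cexp; ring.
  have := mul_sinh_quot (t - kappa lam j) x.
  rewrite eN RtoC_plus !RtoC_mult; set S := (2 * sinh_quot _ _)%C.
  set e := Cexp _; move=> Se.
  have -> : e = ((t - kappa lam j) * S + Cexp (- (x * t)) * Cexp (x * kappa lam j))%C.
    by rewrite Se; ring.
  ring.
by rewrite mE RtoC_mult; ring.
Qed.

(** The mirror image of the computation for E: here the terms in
    e^(-(t - kappa_j) x) cancel. *)
Lemma is_deriveC_F_form (n : nat) (lam : R) (d : R -> nat -> R) (c : nat -> R) (m x : R) (t : C) :
  (forall j, (1 <= j <= n)%nat ->
     is_derive (fun y => d y j) x (- kappa lam j * d x j + m * c j)) ->
  sum_n_m (fun j => 2 * (d x j * exp (- (kappa lam j * x)))) 1 n = m ->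
  is_deriveC (fun y => F_form n lam y (d y) (Ci * t)%C) x
    (- t * F_form n lam x (d x) (Ci * t) + m * E_form n lam x c (Ci * t))%C.
Proof.
move=> dd mE; rewrite /E_form /F_form mul_NCi_Ci.
apply: is_deriveC_eq.
  apply: is_deriveC_plus; last exact: is_deriveC_kernel_sum dd.
  apply: is_deriveC_mult; first exact: is_deriveC_const.
  apply: (@is_deriveC_ext (fun y => Cexp (y * - t)%C)) => [y|]; last exact: is_deriveC_exp.
  by congr Cexp; ring.
have -> : sum_C (fun j =>
       (- kappa lam j * d x j + m * c j)%R * (2 * sinh_quot (t - kappa lam j) x) +
       d x j * (Cexp (x * (t - kappa lam j)) + Cexp (- (x * (t - kappa lam j)))))%C n =
   (- t * kernel_sum n lam x (d x) t + m * kernel_sum n lam x c t +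
    Cexp (x * t) * sum_n_m (fun j => (2 * (d x j * exp (- (kappa lam j * x))))%R) 1 n)%C.
  rewrite -sum_C_RtoC /kernel_sum -!sum_C_mult -!sum_C_plus; apply: sum_C_ext => j _.
  have -> : RtoC (2 * (d x j * exp (- (kappa lam j * x)))) =
      (2 * (d x j * Cexp (- (x * kappa lam j))))%C.
    by rewrite -RtoC_mult -RtoC_opp Cexp_RtoC [(x * _)%R]Rmult_comm !RtoC_mult.
  have eP : Cexp (x * (t - kappa lam j)) = (Cexp (x * t) * Cexp (- (x * kappa lam j)))%C.
    by rewrite -Cexp_plus; congr Cexp; ring.
  have := mul_sinh_quot (t - kappa lam j) x.
  rewrite eP RtoC_plus !RtoC_mult RtoC_opp; set S := (2 * sinh_quot _ _)%C.
  set e := Cexp (- (x * (t - _)))%C; move=> Se.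
  have -> : e = (Cexp (x * t) * Cexp (- (x * kappa lam j)) - (t - kappa lam j) * S)%C.
    by rewrite Se; ring.
  ring.
have -> : (x * - t = - (x * t))%C by ring.
by rewrite mE; ring.
Qed.

Lemma sinh_quot_RtoC (u x : R) :
  (2 * sinh_quot (RtoC u) x)%C =
  RtoC (match Req_EM_T u 0 with
        | left _ => 2 * x
        | right _ => (exp (u * x) - exp (- (u * x))) / u
        end).
Proof.
case: Req_EM_T => u0.
  rewrite /sinh_quot u0; case: Ceq_dec => // _; first by rewrite RtoC_mult.
have u0' : RtoC u <> RtoC 0 by move=> /RtoC_inj.
rewrite RtoC_div // RtoC_minus -!Cexp_RtoC RtoC_opp RtoC_mult (Cmult_comm u x) -mul_sinh_quot.
by field.
Qed.

Lemma E_form_real (n : nat) (lam x : R) (c : nat -> R) (s : R) :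
  E_form n lam x c (- Ci * RtoC s)%C =
  (Cexp (RtoC (- (s * x))) + kernel_sum n lam x c (RtoC (- s)))%C.
Proof.
rewrite /E_form; have -> : (- Ci * (- Ci * RtoC s) = RtoC (- s))%C.
  by apply: injective_projections; rewrite /=; ring.
congr (Cexp _ + _)%C; apply: injective_projections; rewrite /=; ring.
Qed.

Lemma F_form_real (n : nat) (lam x : R) (d : nat -> R) (s : R) :
  F_form n lam x d (- Ci * RtoC s)%C =
  (RtoC ((-1) ^ n) * Cexp (RtoC (s * x)) + kernel_sum n lam x d (RtoC (- s)))%C.
Proof.
rewrite /F_form; have -> : (- Ci * (- Ci * RtoC s) = RtoC (- s))%C.
  by apply: injective_projections; rewrite /=; ring.
congr (_ * Cexp _ + _)%C; apply: injective_projections; rewrite /=; ring.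
Qed.

Lemma Ci_mul_opp (s : R) : (Ci * RtoC (- s) = - Ci * RtoC s)%C.
Proof. by apply: injective_projections; rewrite /=; ring. Qed.

Lemma Re_RtoC_mult (r : R) (z : C) : Re (RtoC r * z)%C = r * Re z.
Proof. by rewrite /Re /=; ring. Qed.

Lemma Cplus_mul_RtoC_inj (z : C) (m1 m2 f : R) : f <> 0 ->
  (z + RtoC m1 * RtoC f = z + RtoC m2 * RtoC f)%C -> m1 = m2.
Proof.
move=> f0 /(f_equal Re); rewrite /= => E; apply: (Rmult_eq_reg_r f) => //; lra.
Qed.

Lemma diff_system_real (n : nat) (lam : R) (m : R -> R) (x s : R) :
  diff_system n lam m -> 0 < x ->
  let z := (- Ci * RtoC s)%C in
  is_derive (fun y => Re (E_fun n lam y z)) x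
    (- s * Re (E_fun n lam x z) + m x * Re (F_fun n lam x z)) /\
  is_derive (fun y => Re (F_fun n lam y z)) x
    (s * Re (F_fun n lam x z) + m x * Re (E_fun n lam x z)).
Proof.
move=> ds x0 z; have [] := ds x (RtoC (- s)) x0; rewrite Ci_mul_opp -/z.
move=> /is_derive_ReC dE /is_derive_ReC dF; split.
  by move: dE; rewrite -!Re_RtoC_mult.
by move: dF; rewrite -!Re_RtoC_mult -RtoC_opp Ropp_involutive.
Qed.

(** A linear system for a pair of functions is a Riccati equation for their
    quotient.  The factor 1/a and the change of sign come from x = - ln a. *)
Lemma is_derive_quotient_riccati (G H : R -> R) (r m a : R) :
  0 < a ->
  is_derive G (- ln a) (- r * G (- ln a) + m * H (- ln a)) ->
  is_derive H (- ln a) (r * H (- ln a) + m * G (- ln a)) ->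
  H (- ln a) <> 0 ->
  let W := fun b => G (- ln b) / H (- ln b) in
  is_derive W a ((2 * r * W a - m * (1 - W a ^ 2)) / a).
Proof.
move=> a0 dG dH H0 W.
have dl : is_derive (fun b => - ln b) a (- / a).
  by apply: is_derive_opp; apply/is_derive_Reals; apply: derivable_pt_lim_ln.
have := is_derive_comp _ (fun b => - ln b) a _ _ (is_derive_div _ _ _ _ _ dG dH H0) dl.
congr is_derive; rewrite /scal /= /mult /= /W; field; split=> //; lra.
Qed.

(** * The rational identities behind the formulas for mu *)

(** In the application w = e^((nu+1) x), s = (-1)^n, N = n, and kap0, kap1 are the
    kernels K(a, 1/a) at nu and nu + 1.  The first equation evaluates 1 + a X Y as
    - N/(w Pb Qb); the other two turn the numerators into kap0 and kap1. *)
Lemma mu_from_XY (a w s N Pa Pb Qa Qb kap0 kap1 : R) :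
  0 < a < 1 -> w <> 0 -> s * s = 1 -> N <> 0 -> Pb <> 0 -> Qb <> 0 ->
  w * (Pb * Qb) - / w * (Pa * Qa) = - N ->
  (a - / a) * kap0 = a * Qa * Pb - / a * Qb * Pa ->
  (a - / a) * kap1 = Qa * Pb - Qb * Pa ->
  let X := s * (/ w * / a) * Pa / Pb in
  let Y := - (s * / w * Qa / Qb) in
  - 2 * s * kap0 = 2 * N * a / (1 - a ^ 2) * ((X + a * Y) / (1 + a * X * Y)) /\
  - 2 * s * kap1 = 2 * N * a / (1 - a ^ 2) * ((a * X + Y) / (1 + a * X * Y)).
Proof.
move=> [a0 a1] w0 ss N0 Pb0 Qb0 HN H0 H1 X Y.
have an0 : a <> 0 by lra.
have a2 : 1 - a ^ 2 <> 0 by nra.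
have denE : 1 + a * X * Y = - N / (w * Pb * Qb).
  rewrite -HN /X /Y.
  have -> : a * (s * (/ w * / a) * Pa / Pb) * - (s * / w * Qa / Qb) =
    - (s * s) * (a * (/ w * / a) * Pa / Pb) * (/ w * Qa / Qb) by field.
  by rewrite ss; field.
have num0 : X + a * Y = - (s * ((a - / a) * kap0)) / (w * Pb * Qb).
  by rewrite H0 /X /Y; field.
have num1 : a * X + Y = - (s * ((a - / a) * kap1)) / (w * Pb * Qb).
  by rewrite H1 /X /Y; field.
by rewrite denE num0 num1; split; field.
Qed.

(** In the application q = e^(nu x/2), so that w/q^2 = e^x = 1/a. *)
Lemma X_value (a w q s Pa Pb : R) :
  a <> 0 -> q <> 0 -> s * s = 1 -> Pb <> 0 -> w = q * q * / a ->
  / q * Pa / (s * (q * Pb)) = s * (/ w * / a) * Pa / Pb.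
Proof.
move=> a0 q0 ss Pb0 ->; have s0 : s <> 0 by move=> s0; rewrite s0 in ss; lra.
rewrite -[/ q * Pa]Rmult_1_l -ss; field; repeat split; assumption.
Qed.

(** In the application p = e^((nu+1) x/2). *)
Lemma Y_value (w p s Qa Qb : R) :
  p <> 0 -> s * s = 1 -> Qb <> 0 -> w = p * p ->
  - (- (/ p * Qa) / (- s * (p * Qb))) = - (s * / w * Qa / Qb).
Proof.
move=> p0 ss Qb0 ->; have s0 : s <> 0 by move=> s0; rewrite s0 in ss; lra.
rewrite -[/ p * Qa]Rmult_1_l -ss; field; repeat split; assumption.
Qed.

(* Arithmetic notations and ring tactics change meaning from here on: they are
   those of the abstract algebraic hierarchy, of which R is an instance. *)
From HB Require Import structures.
From mathcomp Require Import all_boot all_order all_algebra.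
From mathcomp Require Import Rstruct.
From mathcomp Require Import ring.
Import Order.TTheory GRing.Theory Num.Theory.
Local Open Scope ring_scope.
Bind Scope ring_scope with R.
Local Arguments exp x%_ring_scope.

(** * Christoffel-Darboux identities for an abstract moment functional *)

(** Constant polynomials are generalized so that ring treats them as atoms instead
    of descending into their scalars. *)
Ltac poly_ring :=
  rewrite -?mul_polyC;
  repeat match goal with |- context [polyC ?c] => generalize (polyC c); intro end;
  ring.

(** Unlike hornerE, these rules leave products in the form that ring reads. *)
Definition horner_rules := (hornerD, hornerN, hornerZ, hornerM, hornerX, hornerC).

(** What remains of positivity over a field without order; it is all that
    uniqueness of representatives needs. *)
Definition anisotropic (F : fieldType) (L : {scalar {poly F}}) :=
  forall p : {poly F}, L (p * p) = 0 -> p = 0.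

(** p is the Riesz representative of the form l, among the polynomials of degree
    less than n, for the bilinear form (p, q) -> L (p q).  For l the evaluation at v
    this is the reproducing kernel K(., v). *)
Definition represents (F : fieldType) (L : {scalar {poly F}}) (n : nat)
    (p : {poly F}) (l : {poly F} -> F) :=
  (size p <= n)%N /\ forall q : {poly F}, (size q <= n)%N -> L (p * q) = l q.

Lemma size_subr_leq (F : fieldType) (p q : {poly F}) n :
  (size p <= n)%N -> (size q <= n)%N -> (size (p - q)%R <= n)%N.
Proof.
by move=> sp sq; rewrite (leq_trans (size_polyD _ _)) // size_polyN geq_max sp.
Qed.

Lemma represents_inj (F : fieldType) (L : {scalar {poly F}}) n p1 p2 l :
  anisotropic L -> represents L n p1 l -> represents L n p2 l -> p1 = p2.
Proof.
move=> aL [s1 r1] [s2 r2]; apply/eqP; rewrite -subr_eq0; apply/eqP; apply: aL.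
have s12 := size_subr_leq s1 s2.
by rewrite mulrBl linearB /= r1 // r2 // subrr.
Qed.

Lemma size_root_factor (F : fieldType) (p : {poly F}) v n :
  (size p <= n.+1)%N -> p.[v] = 0 ->
  exists2 s : {poly F}, (size s <= n)%N & p = ('X - v%:P) * s.
Proof.
move=> sp /eqP/factor_theorem[s pE]; exists s; last by rewrite mulrC.
have [->|s0] := eqVneq s 0; first by rewrite size_poly0.
by move: sp; rewrite pE size_Mmonic ?monicXsubC // size_XsubC addn2.
Qed.

Lemma size_XsubC_mul (F : fieldType) (v : F) (k : {poly F}) n :
  (size k <= n)%N -> (size ((v%:P - 'X) * k)%R <= n.+1)%N.
Proof.
move=> sk; apply: leq_trans (size_polyMleq _ _) _.
have := size_XsubC v; rewrite -size_polyN opprB => ->; exact: sk.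
Qed.

Lemma size_mulX_leq (F : fieldType) (k : {poly F}) n :
  (size k <= n)%N -> (size ('X * k)%R <= n.+1)%N.
Proof.
move=> sk; apply: leq_trans (size_polyMleq _ _) _.
by rewrite size_polyX.
Qed.

(** q - q(v) is divisible by X - v, so only the constant q(v) survives. *)
Lemma reproducing_up_to_scalar (F : fieldType) (M : {scalar {poly F}}) n v
    (S : {poly F}) : (0 < n)%N ->
  (forall s : {poly F}, (size s < n)%N -> M (('X - v%:P) * S * s) = 0) ->
  forall q : {poly F}, (size q <= n)%N -> M (S * q) = q.[v] * M S.
Proof.
case: n => // n _ orth q sq.
have [||s ss qE] := @size_root_factor F (q - q.[v]%:P) v n.
- by apply: size_subr_leq => //; rewrite (leq_trans (size_polyC_leq1 _)).
- by rewrite !horner_rules subrr.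
have -> : S * q = q.[v] *: S + ('X - v%:P) * S * s.
  by rewrite mulrAC -qE; poly_ring.
by rewrite linearD linearZ /= orth // addr0.
Qed.

(** The difference T of the two sides vanishes at u = v, so T = (X - v) S, and T is
    orthogonal to all degrees below n - 1.  Hence L (S q) = q(v) L S, and it
    suffices to see that L S = 0: testing with q = Q gives Q(v) L S = S(0), which
    is 0 because T(0) = 0. *)
Lemma christoffel_darboux (F : fieldType) (L : {scalar {poly F}}) n (P Q K : {poly F}) v :
  (0 < n)%N -> anisotropic L -> (size P <= n.+1)%N ->
  (forall q : {poly F}, (size q <= n)%N -> L (P * q) = 0) ->
  represents L n Q (horner_eval 0) -> represents L n K (horner_eval v) ->
  P.[0] = 1 -> v != 0 -> Q.[v] != 0 ->
  forall u, (v - u) * K.[u] = v * Q.[v] * P.[u] - u * Q.[u] * P.[v].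
Proof.
rewrite /horner_eval => n0 aL sP oP [sQ rQ] [sK rK] P0 v0 Qv0 u.
pose T := (v%:P - 'X) * K - (v * Q.[v]) *: P + P.[v] *: ('X * Q).
have [||S sS TE] := @size_root_factor F T v n.
- rewrite (leq_trans (size_polyD _ _)) // geq_max size_subr_leq //=.
  + by rewrite (leq_trans (size_scale_leq _ _)) // size_mulX_leq.
  + exact: size_XsubC_mul.
  + exact: leq_trans (size_scale_leq _ _) sP.
- by rewrite /T !horner_rules; ring.
have LT (s : {poly F}) : (size s < n)%N -> L (T * s) = 0.
  move=> ss; have ss' := ltnW ss.
  have -> : T * s = K * ((v%:P - 'X) * s) - (v * Q.[v]) *: (P * s)
      + P.[v] *: (Q * ('X * s)).
    by rewrite /T; poly_ring.
  have sv := leq_trans (size_XsubC_mul v (leqnn _)) ss.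
  have sX := leq_trans (size_mulX_leq (leqnn _)) ss.
  by rewrite linearD linearB !linearZ /= oP // rK // rQ // !horner_rules; ring.
have rS := reproducing_up_to_scalar n0
  (fun s ss => etrans (congr1 (fun t => L (t * s)) (esym TE)) (LT s ss)).
have K0 : K.[0] = Q.[v] by rewrite -rQ // mulrC rK.
have S0 : S.[0] = 0.
  have /eqP : v * S.[0] = 0.
    have /esym := congr1 (horner^~ 0) TE; rewrite /T !horner_rules P0 K0 => TE0.
    have -> : v * S.[0] = - ((0 - v) * S.[0]) by ring.
    by rewrite TE0; ring.
  by rewrite mulf_eq0 (negPf v0) => /eqP.
have LS0 : L S = 0.
  have := rS Q sQ; rewrite mulrC rQ // S0 => /esym/eqP.
  by rewrite mulf_eq0 (negPf Qv0) => /eqP.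
have {}TE : T = 0.
  by rewrite TE (aL S) ?mulr0 // rS // LS0 mulr0.
have := congr1 (horner^~ u) TE; rewrite /T !horner_rules => /eqP.
rewrite -addrA addr_eq0 => /eqP ->; ring.
Qed.

(** The same argument for the weight multiplied by u.  Here L1 S = 0 comes from
    testing with the representative r of L, for which P = 1 - X r. *)
Lemma christoffel_darboux_shift (F : fieldType) (L L1 : {scalar {poly F}}) n
    (P Q K r : {poly F}) v :
  (forall p, L1 p = L ('X * p)) ->
  (0 < n)%N -> anisotropic L1 ->
  (forall q : {poly F}, (size q <= n)%N -> L (P * q) = 0) ->
  represents L n Q (horner_eval 0) -> represents L1 n K (horner_eval v) ->
  represents L1 n r L -> P = 1 - 'X * r -> P.[v] != 0 ->
  forall u, (v - u) * K.[u] = Q.[v] * P.[u] - Q.[u] * P.[v].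
Proof.
rewrite /horner_eval => L1E n0 aL oP [sQ rQ] [sK rK] [sr rr] PE Pv0 u.
pose T := (v%:P - 'X) * K - Q.[v] *: P + P.[v] *: Q.
have sP : (size P <= n.+1)%N.
  by rewrite PE size_subr_leq ?size_poly1 ?size_mulX_leq.
have [||S sS TE] := @size_root_factor F T v n.
- rewrite (leq_trans (size_polyD _ _)) // geq_max size_subr_leq //=.
  + by rewrite (leq_trans (size_scale_leq _ _)) // ltnW.
  + exact: size_XsubC_mul.
  + exact: leq_trans (size_scale_leq _ _) sP.
- by rewrite /T !horner_rules; ring.
have LT (s : {poly F}) : (size s < n)%N -> L1 (T * s) = 0.
  move=> ss; have ss' := ltnW ss; have sX := leq_trans (size_mulX_leq (leqnn _)) ss.
  have -> : T * s = K * ((v%:P - 'X) * s) - Q.[v] *: (P * s) + P.[v] *: (Q * s).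
    by rewrite /T; poly_ring.
  have sv := leq_trans (size_XsubC_mul v (leqnn _)) ss.
  rewrite linearD linearB !linearZ /= rK //.
  by rewrite !L1E (mulrCA 'X P) (mulrCA 'X Q) oP // rQ // !horner_rules; ring.
have rS := reproducing_up_to_scalar n0
  (fun s ss => etrans (congr1 (fun t => L1 (t * s)) (esym TE)) (LT s ss)).
have s1 : (size (1 : {poly F})%R <= n)%N by rewrite size_poly1.
have LK1 : L1 K = 1 by rewrite -[K]mulr1 rK // hornerE.
have LK : L K = r.[v] by rewrite -rr // mulrC rK.
have LQ : L Q = 1 by rewrite -[Q]mulr1 rQ // hornerE.
have LP : L P = 0 by rewrite -[P]mulr1 oP.
have Pv : P.[v] = 1 - v * r.[v] by rewrite PE !horner_rules.
have LS0 : L1 S = 0.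
  have LTE : L T = 0.
    have -> : T = v *: K - 'X * K - Q.[v] *: P + P.[v] *: Q.
      by rewrite /T; poly_ring.
    by rewrite linearD !linearB !linearZ /= -L1E LK1 LK LP LQ Pv; ring.
  have L1S : L1 S = v * L S.
    move: LTE; rewrite TE mulrBl linearB /= -L1E mul_polyC linearZ /= => /eqP.
    by rewrite subr_eq0 => /eqP.
  have := rS r sr; rewrite mulrC rr // => LS.
  have /eqP : P.[v] * L1 S = 0.
    by rewrite Pv mulrBl mul1r -mulrA -LS -L1S subrr.
  by rewrite mulf_eq0 (negPf Pv0) => /eqP.
have {}TE : T = 0.
  by rewrite TE (aL S) ?mulr0 // rS // LS0 mulr0.
have := congr1 (horner^~ u) TE; rewrite /T !horner_rules => /eqP.
rewrite -addrA addr_eq0 => /eqP ->; ring.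
Qed.

(** In the variable s = ln u this is the derivative: e^(cs) euler c p (e^s) is the
    derivative of e^(cs) p(e^s). *)
Definition euler (F : fieldType) (c : F) (p : {poly F}) : {poly F} :=
  'X * p^`() + c *: p.

Lemma coef_euler (F : fieldType) (c : F) (p : {poly F}) k :
  (euler c p)`_k = (c + k%:R) * p`_k.
Proof.
rewrite coefD coefXM coefZ coef_deriv mulrDl mulr_natl addrC.
by case: k => [|k]; rewrite ?mulr0n.
Qed.

Lemma size_euler (F : fieldType) (c : F) (p : {poly F}) n :
  (size p <= n)%N -> (size (euler c p) <= n)%N.
Proof.
move=> sp; apply/leq_sizeP => k nk; rewrite coef_euler nth_default ?mulr0 //.
exact: leq_trans sp nk.
Qed.

Lemma eulerM (F : fieldType) (c d : F) (p q : {poly F}) :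
  euler (c + d) (p * q) = p * euler d q + q * euler c p.
Proof. by rewrite /euler derivM -!mul_polyC polyCD; poly_ring. Qed.

(** X P' - n P has degree less than n, so its product with Q integrates to its value
    at 0, namely - n; the remaining part of euler l (P Q) is P times a polynomial of
    degree less than n. *)
Lemma boundary_pairing (F : fieldType) (L B : {poly F} -> F) n (P Q : {poly F}) (l : F) :
  {morph L : p q / p + q} ->
  (forall p, L (euler l p) = B p) ->
  (size P <= n.+1)%N -> P.[0] = 1 ->
  (forall q : {poly F}, (size q <= n)%N -> L (P * q) = 0) ->
  (size Q <= n)%N ->
  (forall q : {poly F}, (size q <= n)%N -> L (Q * q) = q.[0]) ->
  B (P * Q) = - n%:R.
Proof.
move=> LD LB sP P0 oP sQ rQ.
pose S := euler (- n%:R) P.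
have sS : (size S <= n)%N.
  apply/leq_sizeP => j; rewrite coef_euler leq_eqVlt => /orP[/eqP->|nj].
    by rewrite addNr mul0r.
  by rewrite nth_default ?mulr0 // (leq_trans sP).
have sR := size_euler (n%:R + l) sQ.
(* The Euler exponent l is split as - n, on P, plus n + l, on Q. *)
rewrite -LB -[l](addKr n%:R) eulerM addrC.
by rewrite LD rQ // oP // addr0 /S /euler !horner_rules P0; ring.
Qed.

(** * The moment functional of the weight u^lam on [e^-x, e^x] *)

Lemma is_derive_extR (f g : R -> R) (x l : R) :
  (forall y, f y = g y) -> is_derive f x l -> is_derive g x l.
Proof. exact: is_derive_ext. Qed.

Lemma is_derive_addR (f g : R -> R) (x f' g' : R) :
  is_derive f x f' -> is_derive g x g' ->
  is_derive (fun y => f y + g y) x (f' + g').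
Proof. exact: is_derive_plus. Qed.

Lemma is_derive_mulR (f g : R -> R) (x f' g' : R) :
  is_derive f x f' -> is_derive g x g' ->
  is_derive (fun y => f y * g y) x (f' * g x + f x * g').
Proof. by move=> df dg; apply: is_derive_mult => // *; apply: Rmult_comm. Qed.

Lemma is_derive_mulcR (f : R -> R) (c x f' : R) :
  is_derive f x f' -> is_derive (fun y => c * f y) x (c * f').
Proof. exact: is_derive_scal. Qed.

Lemma is_derive_sumR (I : Type) (s : seq I) (P : pred I) (f : I -> R -> R) (f' : I -> R) (x : R) :
  (forall i, P i -> is_derive (f i) x (f' i)) ->
  is_derive (fun y => \sum_(i <- s | P i) f i y) x (\sum_(i <- s | P i) f' i).
Proof.
move=> df; elim: s => [|i s IHs].
  apply: (is_derive_extR (f := fun=> 0)) => [y|]; rewrite big_nil //.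
  exact: is_derive_const.
rewrite big_cons; case: ifP => Pi.
  apply: (@is_derive_extR (fun y => f i y + \sum_(i <- s | P i) f i y)) => [y|].
    by rewrite big_cons Pi.
  by apply: is_derive_addR => //; apply: df.
by apply: is_derive_extR IHs => y; rewrite big_cons Pi.
Qed.

(** The integral of e^(sy) over y in [-x, x]. *)
Definition exp_moment (s x : R) : R :=
  if s == 0 then x *+ 2 else (exp (s * x) - exp (- (s * x))) / s.

Lemma exp_moment0 s : exp_moment s 0 = 0.
Proof.
by rewrite /exp_moment; case: ifP => _; rewrite ?mul0rn // mulr0 oppr0 subrr mul0r.
Qed.

Lemma mul_exp_moment s x : s * exp_moment s x = exp (s * x) - exp (- (s * x)).
Proof.
rewrite /exp_moment; case: eqVneq => [->|s0]; last by rewrite mulrC divfK.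
by rewrite !mul0r oppr0 subrr.
Qed.

Lemma exp_momentN s x : exp_moment (- s) x = exp_moment s x.
Proof.
rewrite /exp_moment oppr_eq0; case: eqVneq => // s0.
by rewrite mulNr opprK invrN mulrN -mulNr opprB.
Qed.

Lemma is_derive_exp_scale (s x : R) : is_derive (fun y : R => exp (s * y)) x (s * exp (s * x)).
Proof.
have dl : is_derive (fun y : R => s * y) x s.
  by rewrite -[X in is_derive _ _ X]mulr1; apply/is_derive_mulcR/is_derive_id.
exact: (is_derive_comp exp (fun y => s * y) x _ _ (is_derive_exp _) dl).
Qed.

Lemma is_derive_exp_moment s x :
  is_derive (exp_moment s) x (exp (s * x) + exp (- (s * x))).
Proof.
rewrite /exp_moment; case: eqVneq => [->|s0].
  rewrite !mul0r oppr0 exp_0.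
  apply: (@is_derive_extR (fun y => (1 + 1) * y)) => [y|]; first by rewrite -mulr2n mulr_natl.
  by rewrite -[X in is_derive _ _ X]mulr1; apply/is_derive_mulcR/is_derive_id.
apply: (@is_derive_extR (fun y => s^-1 * (exp (s * y) + (-1) * exp ((- s) * y)))) => [y|].
  by rewrite [- s * y]mulNr mulN1r mulrC.
have -> : exp (s * x) + exp (- (s * x)) =
    s^-1 * (s * exp (s * x) + (-1) * ((- s) * exp ((- s) * x))).
  by rewrite [- s * x]mulNr mulN1r mulNr opprK -mulrDr mulKf.
apply: is_derive_mulcR; apply: is_derive_addR; first exact: is_derive_exp_scale.
exact/is_derive_mulcR/is_derive_exp_scale.
Qed.

(** The integral of p(u) u^lam over u in [e^-x, e^x], computed on monomials with
    u = e^y. *)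
Definition moment (lam x : R) (p : {poly R}) : R :=
  \sum_(k < size p) p`_k * exp_moment (lam + 1 + k%:R) x.

Lemma moment_widen lam x n (p : {poly R}) : (size p <= n)%N ->
  moment lam x p = \sum_(k < n) p`_k * exp_moment (lam + 1 + k%:R) x.
Proof.
move=> sp; rewrite /moment (big_ord_widen n (fun k => p`_k * exp_moment (lam + 1 + k%:R) x)) //.
rewrite big_mkcond /=; apply: eq_bigr => k _; case: ltnP => // pk.
by rewrite nth_default // mul0r.
Qed.

Fact moment_is_linear lam x : linear_for *%R (moment lam x).
Proof.
move=> c p q; pose n := maxn (size p) (size q).
have sp : (size p <= n)%N by rewrite leq_max leqnn.
have sq : (size q <= n)%N by rewrite leq_max leqnn orbT.
have sr : (size (c *: p + q)%R <= n)%N.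
  rewrite (leq_trans (size_polyD _ _)) // geq_max sq andbT.
  exact: leq_trans (size_scale_leq _ _) sp.
rewrite (moment_widen _ _ sp) (moment_widen _ _ sq) (moment_widen _ _ sr).
rewrite big_distrr -big_split; apply: eq_bigr => k _ /=.
by rewrite coefD coefZ mulrDl mulrA.
Qed.

HB.instance Definition _ lam x :=
  GRing.isLinear.Build R {poly R} R *%R (moment lam x) (moment_is_linear lam x).

Lemma moment_shift lam x p : moment (lam + 1) x p = moment lam x ('X * p).
Proof.
rewrite (moment_widen _ _ (size_mulX_leq (leqnn (size p)))) big_ord_recl.
rewrite coefXM eqxx mul0r add0r; apply: eq_bigr => k _.
by rewrite coefXM /= /bump add1n -natr1; congr (_ * exp_moment _ _); ring.
Qed.

(** The value of u^c p(u) at the end point u = e^x for e = 1, or u = e^-x for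
    e = -1. *)
Definition end_value (e c x : R) (p : {poly R}) : R :=
  exp (e * (c * x)) * p.[exp (e * x)].

Lemma exp_natmul (k : nat) (x : R) : exp (k%:R * x) = exp x ^+ k.
Proof.
elim: k => [|k IHk]; first by rewrite mul0r expr0 exp_0.
by rewrite -natr1 mulrDl mul1r exprSr -IHk; apply: exp_plus.
Qed.

Lemma expD (x y : R) : exp (x + y) = exp x * exp y.
Proof. exact: exp_plus. Qed.

Lemma end_value_sum e c x n (p : {poly R}) : (size p <= n)%N ->
  end_value e c x p = \sum_(k < n) p`_k * exp (e * ((c + k%:R) * x)).
Proof.
move=> sp; rewrite /end_value (horner_coef_wide _ sp) big_distrr.
apply: eq_bigr => k _ /=; rewrite -exp_natmul mulrCA -expD; congr (_ * exp _); ring.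
Qed.

(** Differentiation under the integral sign, with the two moving end points. *)
Lemma is_derive_moment_family lam x n (p : R -> {poly R}) (p' : {poly R}) :
  (forall y, (size (p y) <= n)%N) -> (size p' <= n)%N ->
  (forall k, is_derive (fun y => (p y)`_k) x p'`_k) ->
  is_derive (fun y => moment lam y (p y)) x
    (moment lam x p' + (end_value 1 (lam + 1) x (p x) + end_value (- 1) (lam + 1) x (p x))).
Proof.
move=> sp sp' dp.
apply: (@is_derive_extR (fun y => \sum_(k < n) (p y)`_k * exp_moment (lam + 1 + k%:R) y)) => [y|].
  by rewrite (moment_widen _ _ (sp y)).
rewrite (moment_widen _ _ sp') !(end_value_sum _ _ _ (sp x)) -!big_split /=.
apply: is_derive_sumR => k _; rewrite -mulrDr mul1r mulN1r.
by apply: is_derive_mulR => //; apply: is_derive_exp_moment.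
Qed.

(** The fundamental theorem of calculus for u^(lam+1) p(u). *)
Lemma moment_euler lam x (p : {poly R}) :
  moment lam x (euler (lam + 1) p) =
  end_value 1 (lam + 1) x p - end_value (- 1) (lam + 1) x p.
Proof.
have sp := leqnn (size p).
rewrite (moment_widen _ _ (size_euler (lam + 1) sp)) !(end_value_sum _ _ _ sp) -sumrB.
apply: eq_bigr => k _; rewrite -mulrBr mul1r mulN1r -mul_exp_moment coef_euler.
by rewrite mulrA [_ * p`_k]mulrC.
Qed.

(** * Positivity of the moment functional *)

Lemma exp_le_mono (y z : R) : (exp y <= exp z) = (y <= z).
Proof.
apply/idP/idP => /RleP H; apply/RleP; last by case: H => [/exp_increasing|->]; [left|right].
case: (Rle_or_lt y z) => // /exp_increasing zy.
by case: (Rlt_not_le _ _ zy).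
Qed.

Lemma exp_gt0 (y : R) : 0 < exp y.
Proof. exact/RltP/exp_pos. Qed.

Lemma is_derive_moment lam y (p : {poly R}) :
  is_derive (fun y => moment lam y p) y (end_value 1 (lam + 1) y p + end_value (-1) (lam + 1) y p).
Proof.
rewrite -[X in is_derive _ _ X]add0r -(linear0 (moment lam y)).
apply: (@is_derive_moment_family lam y (size p) (fun=> p) 0) => //.
  by rewrite size_poly0.
by move=> k; rewrite coef0; apply: is_derive_const.
Qed.

Lemma is_derive_nondecreasing (f df : R -> R) (a b : R) :
  a <= b -> (forall y, is_derive f y (df y)) ->
  (forall y, a <= y <= b -> 0 <= df y) -> f a <= f b.
Proof.
move=> ab fd df0.
have [||c [cab fE]] := MVT_gen f a b df.
- by move=> y _; apply: fd.
- move=> y _; apply/continuity_pt_filterlim/(@ex_derive_continuous R_AbsRing R_NormedModule).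
  by exists (df y); apply: fd.
move: cab; rewrite Rmin_left ?Rmax_right; try exact/RleP.
case=> /RleP ac /RleP cb; rewrite -subr_ge0 [_ - _]fE.
by apply: mulr_ge0; rewrite ?df0 ?ac ?subr_ge0.
Qed.

Lemma poly_infinitely_many_roots (p : {poly R}) (a b : R) :
  a < b -> (forall y, a < y < b -> p.[exp y] = 0) -> p = 0.
Proof.
move=> ab pab; apply/eqP/negPn/negP => p0.
(* As many roots as p has coefficients, one more than its degree allows. *)
pose N := size p; pose y (k : nat) := a + (b - a) * (k.+1%:R / N.+2%:R).
have ba : 0 < b - a by rewrite subr_gt0.
have injy : injective (fun k => exp (y k)).
  move=> j k /exp_inv/addrI/(mulfI (lt0r_neq0 ba))/mulIf.
  by rewrite invr_neq0 ?pnatr_eq0 // => /(_ isT)/eqP; rewrite eqr_nat => /eqP[].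
have := max_poly_roots p0 (rs := [seq exp (y k) | k <- iota 0 N]).
rewrite size_map size_iota ltnn map_inj_uniq // iota_uniq.
suff -> : all (root p) [seq exp (y k) | k <- iota 0 N] by move=> /(_ isT isT).
apply/allP => z /mapP[k]; rewrite mem_iota add0n => /andP[_ kN] ->.
apply/eqP/pab/andP; split; first by rewrite ltrDl mulr_gt0 // divr_gt0 ?ltr0n.
rewrite -ltrBrDl -[ltRHS]mulr1 ltr_pM2l // ltr_pdivrMr ?ltr0n // mul1r ltr_nat.
by rewrite ltnS ltnW.
Qed.

(** The moment is 0 at x = 0 and its derivative in x is the sum of the values of the
    integrand at both ends, so it is nondecreasing.  If it were 0 at x it would be 0
    on [0, x], and p would vanish on an interval. *)
Lemma moment_gt0 lam x (p : {poly R}) :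
  0 < x -> p != 0 -> (forall u, exp (- x) <= u <= exp x -> 0 <= p.[u]) ->
  0 < moment lam x p.
Proof.
move=> x0 pn0 pge0.
have bd e y : e = 1 \/ e = -1 -> 0 <= y <= x -> 0 <= end_value e (lam + 1) y p.
  move=> he /andP[y0 yx]; apply: mulr_ge0; first exact/ltW/exp_gt0.
  have Nxy : - x <= y by apply: le_trans y0; rewrite oppr_le0 ltW.
  have yx' : - y <= x by rewrite lerNl.
  by apply: pge0; rewrite !exp_le_mono; case: he => ->;
    rewrite ?mul1r ?mulN1r ?lerN2 ?yx ?Nxy ?yx'.
have mono y z : 0 <= y -> y <= z -> z <= x -> moment lam y p <= moment lam z p.
  move=> y0 yz zx; apply: (is_derive_nondecreasing yz (fun w => is_derive_moment lam w p)).
  move=> w /andP[yw wz]; have w0x : 0 <= w <= x by rewrite (le_trans y0) //= (le_trans wz).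
  by apply: addr_ge0; apply: bd => //; [left|right].
have m0 : moment lam 0 p = 0.
  by apply: big1 => k _; rewrite exp_moment0 mulr0.
rewrite lt_neqAle -{2}m0 mono ?(ltW x0) // andbT eq_sym; apply/negP => /eqP mx0.
case/eqP: pn0; apply: (poly_infinitely_many_roots x0) => y /andP[y0 yx].
have : end_value 1 (lam + 1) y p + end_value (-1) (lam + 1) y p = 0.
  rewrite -(is_derive_unique _ _ _ (is_derive_moment lam y p)).
  apply: is_derive_unique.
  apply: (@is_derive_ext_loc R_AbsRing R_NormedModule (fun=> 0)); last exact: is_derive_const.
  have /RltP y0' := y0; have /RltP yx' := yx.
  apply: (filter_imp (fun z => Rlt 0 z /\ Rlt z x)); last first.
    apply: filter_and; [exact: open_gt | exact: open_lt].
  move=> z [/RltP z0 /RltP zx]; apply/eqP; rewrite eq_le.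
  rewrite -{1}m0 mono ?(ltW z0) ?(ltW zx) //= -mx0 mono ?(ltW z0) ?(ltW zx) //.
have y0x : 0 <= y <= x by rewrite !ltW.
have b1 := bd 1 y (or_introl erefl) y0x; have b2 := bd (-1) y (or_intror erefl) y0x.
move/eqP; rewrite paddr_eq0 //.
case/andP=> /eqP; rewrite /end_value mul1r => /eqP.
by rewrite mulf_eq0 (gt_eqF (exp_gt0 _)) !mul1r => /eqP.
Qed.

Lemma moment_anisotropic lam x : 0 < x -> anisotropic (moment lam x).
Proof.
move=> x0 p Lp; apply/eqP/negPn/negP => p0.
have : 0 < moment lam x (p * p).
  apply: moment_gt0; rewrite ?mulf_neq0 // => u _.
  by rewrite hornerM -expr2 sqr_ge0.
by rewrite Lp ltxx.
Qed.

(** If v were a root, p = (X - v) s, then p s = (X - v) s^2 would have the constant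
    sign sg on the interval and yet integrate to 0. *)
Lemma ortho_endpoint_neq0 lam x n (p : {poly R}) (sg v : R) :
  0 < x -> p != 0 -> (size p <= n.+1)%N ->
  (forall q : {poly R}, (size q <= n)%N -> moment lam x (p * q) = 0) ->
  sg != 0 ->
  (forall u, exp (- x) <= u <= exp x -> 0 <= sg * (u - v)) ->
  p.[v] != 0.
Proof.
move=> x0 p0 sp op sg0 sgv; apply/eqP => /(size_root_factor sp)[s ss pE].
have s0 : s != 0 by apply: contra_neq p0 => s0; rewrite pE s0 mulr0.
have : 0 < moment lam x (sg *: (p * s)).
  apply: moment_gt0; rewrite ?scaler_eq0 ?mulf_eq0 ?negb_or ?sg0 ?p0 // => u uI.
  rewrite pE !horner_rules.
  have -> : sg * ((u - v) * s.[u] * s.[u]) = (sg * (u - v)) * s.[u] ^+ 2 by ring.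
  by rewrite mulr_ge0 ?sgv ?sqr_ge0.
by rewrite linearZ /= op // mulr0 ltxx.
Qed.

Lemma ortho_horner_exp_neq0 lam x n (p : {poly R}) :
  0 < x -> p != 0 -> (size p <= n.+1)%N ->
  (forall q : {poly R}, (size q <= n)%N -> moment lam x (p * q) = 0) ->
  p.[exp x] != 0 /\ p.[exp (- x)] != 0.
Proof.
move=> x0 p0 sp op; split.
- apply: (@ortho_endpoint_neq0 lam x n p (-1)) => // [|u /andP[_ ux]].
    by rewrite oppr_eq0 oner_eq0.
  by rewrite mulN1r opprB subr_ge0.
- apply: (@ortho_endpoint_neq0 lam x n p 1) => // [|u /andP[ux _]].
    by rewrite oner_eq0.
  by rewrite mul1r subr_ge0.
Qed.

Definition gram (F : fieldType) n (m : nat -> F) : 'M[F]_n := \matrix_(i, j) m (i + j)%N.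

(** The representative as an explicit solution of the Gram system: this form shows
    that it depends differentiably on the moments. *)
Definition riesz (F : fieldType) n (m l : nat -> F) : {poly F} :=
  rVpoly ((\row_(j < n) l j) *m invmx (gram n m)).

Lemma poly_sum_monomials (F : fieldType) n (q : {poly F}) :
  (size q <= n)%N -> q = \sum_(j < n) q`_j *: 'X^j.
Proof.
move=> sq; rewrite -(poly_def n (fun j => q`_j)); apply/polyP => j; rewrite coef_poly.
by case: ltnP => // nj; rewrite nth_default // (leq_trans sq).
Qed.

Lemma scalar_gram (F : fieldType) (L : {scalar {poly F}}) n (w : 'rV[F]_n) (q : {poly F}) :
  (size q <= n)%N ->
  L (rVpoly w * q) = \sum_(j < n) q`_j * (w *m gram n (fun k => L 'X^k)) 0 j.
Proof.
move=> sq.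
rewrite {1}(poly_sum_monomials sq).
have -> : rVpoly w = \sum_(i < n) w 0 i *: 'X^i.
  rewrite {1}(row_sum_delta w) linear_sum; apply: eq_bigr => i _.
  by rewrite linearZ /= rVpoly_delta.
rewrite mulr_sumr linear_sum; apply: eq_bigr => j _; rewrite -scalerAr linearZ /=.
congr (_ * _); rewrite mulr_suml linear_sum mxE; apply: eq_bigr => i _.
by rewrite -scalerAl linearZ /= mxE exprD.
Qed.

Lemma gram_unit (F : fieldType) (L : {scalar {poly F}}) n :
  anisotropic L -> gram n (fun k => L 'X^k) \in unitmx.
Proof.
move=> aL; rewrite -row_free_unit; apply: inj_row_free => w wG.
rewrite -[w]rVpolyK (aL (rVpoly w)) ?linear0 //.
rewrite scalar_gram ?size_poly // big1 // => j _.
by rewrite wG mxE mulr0.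
Qed.

Lemma riesz_represents (F : fieldType) (L : {scalar {poly F}}) n (l : nat -> F) :
  anisotropic L ->
  represents L n (riesz n (fun k => L 'X^k) l) (fun q => \sum_(k < n) q`_k * l k).
Proof.
move=> aL; split=> [|q sq]; first exact: size_poly.
rewrite /riesz scalar_gram //; apply: eq_bigr => j _.
by rewrite mulmxKV ?gram_unit // mxE.
Qed.

(** * Reproducing kernels at the end points and their derivatives in x *)

Lemma ex_derive_sumR (I : Type) (s : seq I) (P : pred I) (f : I -> R -> R) (x : R) :
  (forall i, ex_derive (f i) x) ->
  ex_derive (fun y => \sum_(i <- s | P i) f i y) x.
Proof.
move=> df; exists (\sum_(i <- s | P i) Derive (f i) x); apply: is_derive_sumR => i _.
exact: Derive_correct.
Qed.

Lemma ex_derive_mulR (f g : R -> R) (x : R) :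
  ex_derive f x -> ex_derive g x -> ex_derive (fun y => f y * g y) x.
Proof. by case=> a fa [b gb]; exists (a * g x + f x * b); apply: is_derive_mulR. Qed.

Lemma ex_derive_prodR (I : Type) (s : seq I) (f : I -> R -> R) (x : R) :
  (forall i, ex_derive (f i) x) ->
  ex_derive (fun y => \prod_(i <- s) f i y) x.
Proof.
move=> df; elim: s => [|i s IHs].
  apply: (@ex_derive_ext R_AbsRing R_NormedModule (fun=> 1 : R)) => [y|]; first by rewrite big_nil.
  exact: ex_derive_const.
apply: (@ex_derive_ext R_AbsRing R_NormedModule (fun y => f i y * \prod_(i <- s) f i y)) => [y|].
  by rewrite big_cons.
exact: ex_derive_mulR.
Qed.

Lemma ex_derive_det n (A : R -> 'M[R]_n) (x : R) :
  (forall i j, ex_derive (fun y => A y i j) x) -> ex_derive (fun y => \det (A y)) x.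
Proof.
move=> dA; apply: ex_derive_sumR => s; apply: ex_derive_mulR; first exact: ex_derive_const.
exact: ex_derive_prodR.
Qed.

(** By Cramer's rule the entries of the inverse are rational functions of the
    entries. *)
Lemma ex_derive_invmx n (A : R -> 'M[R]_n) (x : R) :
  (forall i j, ex_derive (fun y => A y i j) x) ->
  locally x (fun y => A y \in unitmx) ->
  forall i j, ex_derive (fun y => invmx (A y) i j) x.
Proof.
move=> dA uA i j.
apply: (@ex_derive_ext_loc R_AbsRing R_NormedModule (fun y => / \det (A y) * \adj (A y) i j)).
  move: uA; apply: filter_imp => y uAy; rewrite /invmx uAy RinvE; by rewrite [RHS]mxE.
apply: ex_derive_mulR.
  apply: ex_derive_inv; first exact: ex_derive_det.
  by have := locally_singleton _ _ uA; rewrite unitmxE unitfE => /eqP.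
apply: (@ex_derive_ext R_AbsRing R_NormedModule (fun y => cofactor (A y) j i)) => [y|].
  by rewrite mxE.
apply: ex_derive_mulR; first exact: ex_derive_const.
apply: ex_derive_det => k l.
apply: (@ex_derive_ext R_AbsRing R_NormedModule (fun y => A y (lift j k) (lift i l))) => // y.
by rewrite !mxE.
Qed.

Lemma ex_derive_riesz n (m l : R -> nat -> R) (x : R) :
  (forall k, ex_derive (fun y => m y k) x) ->
  (forall k, ex_derive (fun y => l y k) x) ->
  locally x (fun y => gram n (m y) \in unitmx) ->
  forall k, ex_derive (fun y => (riesz n (m y) (l y))`_k) x.
Proof.
move=> dm dl um k; have [kn|nk] := ltnP k n; last first.
  apply: (@ex_derive_ext R_AbsRing R_NormedModule (fun=> 0 : R)) => [y|]; last first.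
    exact: ex_derive_const.
  by rewrite nth_default // (leq_trans (size_poly _ _)).
apply: (@ex_derive_ext R_AbsRing R_NormedModule
   (fun y => \sum_(j < n) l y j * invmx (gram n (m y)) j (Ordinal kn))) => [y|].
  rewrite (coef_rVpoly_ord _ (Ordinal kn)) mxE; apply: eq_bigr => j _.
  by rewrite mxE.
apply: ex_derive_sumR => j; apply: ex_derive_mulR => //.
apply: ex_derive_invmx => // i i'.
by apply: (@ex_derive_ext R_AbsRing R_NormedModule (fun y => m y (i + i')%N)) => // y; rewrite mxE.
Qed.

Lemma moment_Xn lam x k : moment lam x 'X^k = exp_moment (lam + 1 + k%:R) x.
Proof.
have sk : (size ('X^k : {poly R}) <= k.+1)%N by rewrite size_polyXn.
rewrite (moment_widen _ _ sk) big_ord_recr /= coefXn eqxx mul1r big1 ?add0r // => i _.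
by rewrite coefXn ltn_eqF ?mul0r.
Qed.

(** The kernel K(., v) at the end point v = e^(e x), times v^((lam+1)/2).  This half
    of the weight makes the derivatives of the two kernels mirror images. *)
Definition kern n lam e x : {poly R} :=
  riesz n (fun k => exp_moment (lam + 1 + k%:R) x)
    (fun k => exp (e * (((lam + 1) / 2%:R + k%:R) * x))).

Lemma gram_moment n lam x :
  gram n (fun k => exp_moment (lam + 1 + k%:R) x) = gram n (fun k => moment lam x 'X^k).
Proof. by apply/matrixP => i j; rewrite !mxE moment_Xn. Qed.

Lemma gram_moment_unit n lam x : 0 < x ->
  gram n (fun k => exp_moment (lam + 1 + k%:R) x) \in unitmx.
Proof. by move=> x0; rewrite gram_moment; apply/gram_unit/moment_anisotropic. Qed.

Lemma riesz_moment_represents n lam x l : 0 < x ->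
  represents (moment lam x) n (riesz n (fun k => exp_moment (lam + 1 + k%:R) x) l)
    (fun q => \sum_(k < n) q`_k * l k).
Proof.
move=> x0; rewrite /riesz gram_moment.
exact/riesz_represents/moment_anisotropic.
Qed.

Lemma represents_ext (F : fieldType) (L : {scalar {poly F}}) n p l1 l2 :
  (forall q : {poly F}, (size q <= n)%N -> l1 q = l2 q) ->
  represents L n p l1 -> represents L n p l2.
Proof. by move=> ll [sp rp]; split=> // q sq; rewrite rp // ll. Qed.

Lemma kern_represents n lam e x : 0 < x ->
  represents (moment lam x) n (kern n lam e x) (end_value e ((lam + 1) / 2%:R) x).
Proof.
move=> x0; apply: represents_ext (riesz_moment_represents n lam _ x0) => q sq.
by rewrite (end_value_sum _ _ _ sq).
Qed.

Lemma locally_pos (x : R) (P : R -> Prop) :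
  0 < x -> (forall y, 0 < y -> P y) -> locally x P.
Proof.
move=> /RltP x0 Py; apply: (filter_imp (Rlt 0)); last exact: open_gt.
by move=> y /RltP; apply: Py.
Qed.

Lemma ex_derive_kern n lam e x k : 0 < x ->
  ex_derive (fun y => (kern n lam e y)`_k) x.
Proof.
move=> x0; apply: ex_derive_riesz => [j|j|].
- by eexists; apply: is_derive_exp_moment.
- exists (e * ((lam + 1) / 2%:R + j%:R) * exp (e * (((lam + 1) / 2%:R + j%:R) * x))).
  rewrite mulrA.
  apply: is_derive_extR (is_derive_exp_scale (e * ((lam + 1) / 2%:R + j%:R)) x) => y.
  by rewrite mulrA.
- by apply: locally_pos => // y; apply: gram_moment_unit.
Qed.

Lemma end_valueM e c d x p q :
  end_value e (c + d) x (p * q) = end_value e c x p * end_value e d x q.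
Proof. by rewrite /end_value mulrDl mulrDr expD hornerM mulrACA. Qed.

Lemma is_derive_end_value e c x (q : {poly R}) :
  is_derive (fun y => end_value e c y q) x (e * end_value e c x (euler c q)).
Proof.
have sq := leqnn (size q).
apply: (@is_derive_extR (fun y => \sum_(k < size q) q`_k * exp (e * (c + k%:R) * y))) => [y|].
  by rewrite (end_value_sum _ _ _ sq); apply: eq_bigr => k _; rewrite mulrA.
rewrite (end_value_sum _ _ _ (size_euler c sq)) big_distrr /=.
apply: is_derive_sumR => k _.
have -> : e * ((euler c q)`_k * exp (e * ((c + k%:R) * x))) =
   q`_k * (e * (c + k%:R) * exp (e * (c + k%:R) * x)).
  by rewrite coef_euler [e * (_ * x)]mulrA; ring.
exact/is_derive_mulcR/is_derive_exp_scale.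
Qed.

(** By the reproducing property this is K(e^x, e^-x): the two half weights are
    inverse to each other. *)
Definition kern_pairing n lam x := moment lam x (kern n lam 1 x * kern n lam (- 1) x).

(** The reproducing identity L (K q) = u^((lam+1)/2) q(u) at u = e^(e x),
    differentiated in x. *)
Lemma kern_derivative_represents n lam e x (K' : {poly R}) : 0 < x ->
  (size K' <= n)%N ->
  (forall k, is_derive (fun y => (kern n lam e y)`_k) x K'`_k) ->
  forall q : {poly R}, (size q <= n)%N ->
  moment lam x (K' * q) +
    (end_value 1 (lam + 1) x (kern n lam e x * q) +
     end_value (- 1) (lam + 1) x (kern n lam e x * q)) =
  e * moment lam x (kern n lam e x * euler ((lam + 1) / 2%:R) q).
Proof.
move=> x0 sK' dK q sq; have rK y (y0 : 0 < y) := kern_represents n lam e y0.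
have [_ ->] := rK x x0; last exact: size_euler.
have dl := is_derive_end_value e ((lam + 1) / 2%:R) x q.
have {}dl := @is_derive_ext_loc R_AbsRing R_NormedModule _
  (fun y => moment lam y (kern n lam e y * q)) _ _ _ dl.
rewrite -(is_derive_unique _ _ _ (dl _)); last first.
  by apply: locally_pos => // y y0; have [_ ->] := rK y y0.
symmetry; apply: is_derive_unique.
apply: (@is_derive_moment_family lam x (n + n) (fun y => kern n lam e y * q)).
- move=> y; apply: leq_trans (size_polyMleq _ _) _.
  by rewrite (leq_trans (leq_pred _)) // leq_add // size_poly.
- apply: leq_trans (size_polyMleq _ _) _.
  by rewrite (leq_trans (leq_pred _)) // leq_add.
move=> k; rewrite coefM.
apply: (@is_derive_extR (fun y => \sum_(j < k.+1) (kern n lam e y)`_j * q`_(k - j))) => [y|].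
  by rewrite coefM.
apply: is_derive_sumR => j _.
rewrite -[X in is_derive _ _ X]addr0 -[X in _ + X](mulr0 (kern n lam e x)`_j).
by apply: is_derive_mulR => //; apply: is_derive_const.
Qed.

(** Moving the Euler operator from q to the kernel by parts cancels the contribution
    of the end point e^(e x) in the differentiated identity.  What the other end
    point contributes is read, through its own reproducing property, as a multiple of
    the other kernel. *)
Lemma is_derive_kern n lam e x k : e = 1 \/ e = - 1 -> 0 < x ->
  is_derive (fun y => (kern n lam e y)`_k) x
    (- e * (((lam + 1) / 2%:R + k%:R) * (kern n lam e x)`_k)
     - 2%:R * kern_pairing n lam x * (kern n lam (- e) x)`_k).
Proof.
move=> he x0; pose c := (lam + 1) / 2%:R.
pose K' := \poly_(j < n) Derive (fun y => (kern n lam e y)`_j) x.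
have sK' : (size K' <= n)%N by apply: size_poly.
have dK j : is_derive (fun y => (kern n lam e y)`_j) x K'`_j.
  have dj := Derive_correct _ _ (ex_derive_kern n lam e j x0).
  rewrite coef_poly; case: ltnP => // nj.
  apply: (@is_derive_extR (fun=> 0 : R)) => [y|]; last exact: is_derive_const.
  by rewrite nth_default // (leq_trans (size_poly _ _)).
have rK f := kern_represents n lam f x0.
suff K'E : K' = - e *: euler c (kern n lam e x)
    - (2%:R * kern_pairing n lam x) *: kern n lam (- e) x.
  by have := dK k; rewrite K'E coefB !coefZ coef_euler.
set K := kern n lam e x in rK *; set KN := kern n lam (- e) x.
set D := RHS.
have sD : (size D <= n)%N.
  apply: size_subr_leq; apply: leq_trans (size_scale_leq _ _) _; last exact: size_poly.
  by apply: size_euler; apply: size_poly.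
apply: (represents_inj (L := moment lam x) (n := n) (l := fun q => moment lam x (D * q))
  (@moment_anisotropic lam x x0)); last by split.
split=> // q sq /=.
have := kern_derivative_represents x0 sK' dK sq; rewrite -/K -/c => /(canRL (addrK _)) ->.
have cc : lam + 1 = c + c by rewrite /c -mulr2n -[_ *+ 2]mulr_natr divfK ?pnatr_eq0.
have := moment_euler lam x (K * q).
have -> : euler (lam + 1) (K * q) = K * euler c q + q * euler c K by rewrite cc eulerM.
rewrite linearD /= => /(canRL (addrK _)) ->.
have -> : moment lam x (D * q) = - e * moment lam x (q * euler c K)
   - 2%:R * kern_pairing n lam x * moment lam x (KN * q).
  by rewrite /D mulrBl -!scalerAl linearB !linearZ /= [_ * q]mulrC.
have pairE f g : end_value f (lam + 1) x (kern n lam g x * q) =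
    moment lam x (kern n lam f x * kern n lam g x) * moment lam x (kern n lam f x * q).
  rewrite cc end_valueM; have [_ ->] := rK f; last exact: size_poly.
  by have [_ ->] := rK f.
rewrite /K /KN /kern_pairing; case: he => ->; rewrite ?opprK !pairE.
  by rewrite [kern n lam (-1) x * _]mulrC; ring.
by ring.
Qed.

(** * The coefficients of E and F are reproducing kernels *)

Lemma sum_n_m_big (f : nat -> R) n : sum_n_m f 1 n = \sum_(j < n) f j.+1.
Proof.
elim: n => [|n IHn]; first by rewrite big_ord0 sum_n_m_zero //; apply/ssrnat.ltP.
by rewrite sum_n_Sm ?IHn ?big_ord_recr //; apply/ssrnat.leP.
Qed.

Lemma IZR2E : IZR 2 = 2%:R.
Proof. by rewrite -[2%:R]INRE. Qed.

Lemma kappaS lam i : kappa lam i.+1 = (lam + 1) / 2%:R + i%:R.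
Proof.
by rewrite /kappa INRE RminusE !RplusE RdivE IZR2E R1E -(natr1 i) addrA addrK.
Qed.

Lemma sinh_quot_exp_moment (u x : R) :
  (RtoC (IZR 2) * sinh_quot (RtoC u) x)%C = RtoC (exp_moment u x).
Proof.
rewrite sinh_quot_RtoC /exp_moment; case: Req_dec_T => u0; case: eqVneq => // u0'.
  by rewrite IZR2E RmultE mulr_natl.
by case/eqP: u0'.
Qed.

(** At a real point the terms of the sum are moments of monomials, for a weight that
    depends on the point. *)
Lemma kernel_sum_real n lam x (c : nat -> R) (p : {poly R}) (s : R) :
  (size p <= n)%N -> (forall j, (j < n)%N -> c j.+1 = p`_j) ->
  kernel_sum n lam x c (RtoC (- s)) = RtoC (moment (s + (lam + 1) / 2%:R - 1) x p).
Proof.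
move=> sp cp; rewrite (moment_widen _ _ sp) /kernel_sum.
transitivity (sum_C (fun j => RtoC (c j * exp_moment (s + kappa lam j) x)) n).
  apply: sum_C_ext => -[|j] [/ssrnat.leP j1 /ssrnat.leP jn] //.
  rewrite -RtoC_minus sinh_quot_exp_moment -RtoC_mult; congr (RtoC (_ * _)).
  by rewrite RminusE -opprD exp_momentN.
rewrite sum_C_RtoC sum_n_m_big; congr RtoC; apply: eq_bigr => j _.
by rewrite cp // kappaS; congr (_ * exp_moment _ _); ring.
Qed.

Lemma E_form_at n lam x (c : nat -> R) (p : {poly R}) (s : R) :
  (size p <= n)%N -> (forall j, (j < n)%N -> c j.+1 = p`_j) ->
  E_form n lam x c (- Ci * RtoC s)%C =
  RtoC (exp (- (s * x)) + moment (s + (lam + 1) / 2%:R - 1) x p).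
Proof.
move=> sp cp; rewrite E_form_real (kernel_sum_real _ _ _ sp cp) Cexp_RtoC.
by rewrite -RtoC_plus.
Qed.

Lemma F_form_at n lam x (d : nat -> R) (p : {poly R}) (s : R) :
  (size p <= n)%N -> (forall j, (j < n)%N -> d j.+1 = p`_j) ->
  F_form n lam x d (- Ci * RtoC s)%C =
  RtoC ((-1) ^+ n * exp (s * x) + moment (s + (lam + 1) / 2%:R - 1) x p).
Proof.
move=> sp dp; rewrite F_form_real (kernel_sum_real _ _ _ sp dp) Cexp_RtoC.
by rewrite -RtoC_mult -RtoC_plus RpowE.
Qed.

Lemma moment_mulXn lam x i p : moment lam x ('X^i * p) = moment (lam + i%:R) x p.
Proof.
elim: i lam => [|i IHi] lam; first by rewrite mul1r addr0.
by rewrite exprS -mulrA -moment_shift IHi -natr1 addrAC addrA.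
Qed.

Lemma represents_monomials (F : fieldType) (L : {scalar {poly F}}) n (p : {poly F}) (l : nat -> F) :
  (size p <= n)%N -> (forall i, (i < n)%N -> L ('X^i * p) = l i) ->
  represents L n p (fun q => \sum_(k < n) q`_k * l k).
Proof.
move=> sp lp; split=> // q sq.
rewrite {1}(poly_sum_monomials sq).
rewrite mulr_sumr linear_sum; apply: eq_bigr => k _.
by rewrite -scalerAr linearZ /= mulrC [p * _]mulrC lp // mulrC.
Qed.

(** At -i kappa_(i+1) the sum over j is the moment of X^i p, so the zeros prescribe
    all these moments: up to the factor -z, they are those of a kernel. *)
Lemma zeros_represents n lam x (e z : R) (p : {poly R}) : 0 < x ->
  (size p <= n)%N ->
  (forall i, (i < n)%N -> z * exp (e * (((lam + 1) / 2%:R + i%:R) * x)) +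
     moment ((lam + 1) / 2%:R + i%:R + (lam + 1) / 2%:R - 1) x p = 0) ->
  p = - z *: kern n lam e x.
Proof.
move=> x0 sp zp; apply: (represents_inj (n := n) (@moment_anisotropic lam x x0)).
  apply: (@represents_monomials _ _ _ _
    (fun i => - (z * exp (e * (((lam + 1) / 2%:R + i%:R) * x))))) => // i il.
  rewrite /= moment_mulXn; apply/eqP; rewrite -addr_eq0 addrC -(zp i il); apply/eqP.
  by congr (_ + moment _ _ _); field.
split; first by rewrite (leq_trans (size_scale_leq _ _)) // size_poly.
move=> q sq; rewrite -scalerAl linearZ /=.
have [_ ->] := kern_represents n lam e x0; last by [].
rewrite (end_value_sum _ _ _ sq) mulr_sumr; apply: eq_bigr => k _; ring.
Qed.

(** Existence of the coefficients, needed to use that c_coef and d_coef satisfy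
    the conditions that define them. *)
Lemma kern_zeros n lam x (e z : R) i : 0 < x -> (i < n)%N ->
  z * exp (e * (((lam + 1) / 2%:R + i%:R) * x)) +
     moment ((lam + 1) / 2%:R + i%:R + (lam + 1) / 2%:R - 1) x (- z *: kern n lam e x) = 0.
Proof.
move=> x0 il; rewrite linearZ /=.
have -> : (lam + 1) / 2%:R + i%:R + (lam + 1) / 2%:R - 1 = lam + i%:R by field.
have sXi : (size ('X^i : {poly R}) <= n)%N by rewrite size_polyXn.
rewrite -moment_mulXn mulrC [_ * kern _ _ _ _]mulrC.
have [_ ->] := kern_represents n lam e x0; last by [].
rewrite (end_value_sum _ _ _ sXi) (bigD1 (Ordinal il)) //= coefXn eqxx mul1r.
rewrite big1 ?addr0; last first.
  by move=> k; rewrite -val_eqE coefXn /= => /negbTE ->; rewrite mul0r.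
ring.
Qed.

Lemma coef_poly_shift n (c : nat -> R) j : (j < n)%N -> c j.+1 = (\poly_(k < n) c k.+1)`_j.
Proof. by move=> jn; rewrite coef_poly jn. Qed.

Definition E_poly n lam x : {poly R} := - kern n lam (-1) x.
Definition F_poly n lam x : {poly R} := - (-1) ^+ n *: kern n lam 1 x.

Lemma c_coefE n lam x j : 0 < x -> (j < n)%N ->
  c_coef n lam x j.+1 = (E_poly n lam x)`_j.
Proof.
move=> x0 jn.
have kS i : (i < n)%N -> (1 <= i.+1)%coq_nat /\ (i.+1 <= n)%coq_nat.
  by move=> il; split; apply/ssrnat.leP.
have : trivial_zeros n lam (E_form n lam x (c_coef n lam x)).
  apply: (epsilon_spec _ (fun c => trivial_zeros n lam (E_form n lam x c))).
  exists (fun j => (E_poly n lam x)`_j.-1) => -[|i] [/ssrnat.leP i1 /ssrnat.leP il] //.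
  rewrite (@E_form_at _ _ _ _ (E_poly n lam x)) //; last by rewrite size_polyN size_poly.
  rewrite kappaS; congr RtoC.
  have := @kern_zeros n lam x (-1) 1 i x0 il.
  by rewrite mul1r mulN1r scaleN1r.
move=> tz; rewrite (coef_poly_shift _ jn); apply: (congr1 (fun p : {poly R} => p`_j)).
rewrite /E_poly -(scaleN1r (kern n lam (-1) x)).
apply: (@zeros_represents n lam x (-1) 1) => //; rewrite ?size_poly // => i il.
have := tz i.+1 (kS i il).
rewrite (@E_form_at _ _ _ _ (\poly_(k < n) c_coef n lam x k.+1)) ?size_poly //; last first.
  exact: coef_poly_shift.
by move/RtoC_inj; rewrite kappaS mul1r mulN1r.
Qed.

Lemma d_coefE n lam x j : 0 < x -> (j < n)%N ->
  d_coef n lam x j.+1 = (F_poly n lam x)`_j.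
Proof.
move=> x0 jn.
have kS i : (i < n)%N -> (1 <= i.+1)%coq_nat /\ (i.+1 <= n)%coq_nat.
  by move=> il; split; apply/ssrnat.leP.
have : trivial_zeros n lam (F_form n lam x (d_coef n lam x)).
  apply: (epsilon_spec _ (fun d => trivial_zeros n lam (F_form n lam x d))).
  exists (fun j => (F_poly n lam x)`_j.-1) => -[|i] [/ssrnat.leP i1 /ssrnat.leP il] //.
  rewrite (@F_form_at _ _ _ _ (F_poly n lam x)) //; last first.
    by rewrite (leq_trans (size_scale_leq _ _)) // size_poly.
  rewrite kappaS; congr RtoC.
  have := @kern_zeros n lam x 1 ((-1) ^+ n) i x0 il.
  by rewrite mul1r.
move=> tz; rewrite (coef_poly_shift _ jn); apply: (congr1 (fun p : {poly R} => p`_j)).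
rewrite /F_poly; apply: zeros_represents => //; rewrite ?size_poly // => i il.
have := tz i.+1 (kS i il).
rewrite (@F_form_at _ _ _ _ (\poly_(k < n) d_coef n lam x k.+1)) ?size_poly //; last first.
  exact: coef_poly_shift.
by move/RtoC_inj; rewrite kappaS mul1r.
Qed.

(** * The differential system in x *)

Lemma E_fun_coef n lam x z : 0 < x ->
  E_fun n lam x z = E_form n lam x (fun j => (E_poly n lam x)`_j.-1) z.
Proof.
move=> x0; rewrite /E_fun /E_form; congr Cplus; apply: kernel_sum_ext.
by case=> [|j] [/ssrnat.leP j1 /ssrnat.leP jn] //; rewrite c_coefE.
Qed.

Lemma F_fun_coef n lam x z : 0 < x ->
  F_fun n lam x z = F_form n lam x (fun j => (F_poly n lam x)`_j.-1) z.
Proof.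
move=> x0; rewrite /F_fun /F_form; congr Cplus; apply: kernel_sum_ext.
by case=> [|j] [/ssrnat.leP j1 /ssrnat.leP jn] //; rewrite d_coefE.
Qed.

Definition mu_pairing n lam x : R := - (2%:R * (-1) ^+ n * kern_pairing n lam x).

Lemma kern_pairing_end n lam x e : e = 1 \/ e = -1 -> 0 < x ->
  end_value e ((lam + 1) / 2%:R) x (kern n lam (- e) x) = kern_pairing n lam x.
Proof.
move=> he x0; have [_ <-] := kern_represents n lam e x0; last exact: size_poly.
by case: he => ->; rewrite /kern_pairing ?opprK // mulrC.
Qed.

Lemma is_derive_E_poly n lam x k : 0 < x ->
  is_derive (fun y => (E_poly n lam y)`_k) x
    (((lam + 1) / 2%:R + k%:R) * (E_poly n lam x)`_k + mu_pairing n lam x * (F_poly n lam x)`_k).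
Proof.
move=> x0; have d := is_derive_mulcR (-1) (is_derive_kern n lam k (or_intror erefl) x0).
have -> : ((lam + 1) / 2%:R + k%:R) * (E_poly n lam x)`_k +
    mu_pairing n lam x * (F_poly n lam x)`_k =
   -1 * (- -1 * (((lam + 1) / 2%:R + k%:R) * (kern n lam (-1) x)`_k) -
      2%:R * kern_pairing n lam x * (kern n lam (- -1) x)`_k).
  rewrite /E_poly /F_poly coefN coefZ /mu_pairing opprK.
  have -> : - (2%:R * (-1) ^+ n * kern_pairing n lam x) * (- (-1) ^+ n * (kern n lam 1 x)`_k)
    = ((-1) ^+ n * (-1) ^+ n) * (2%:R * kern_pairing n lam x * (kern n lam 1 x)`_k) by ring.
  by rewrite -expr2 sqrr_sign; ring.
by apply: is_derive_extR d => y; rewrite coefN mulN1r.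
Qed.

Lemma is_derive_F_poly n lam x k : 0 < x ->
  is_derive (fun y => (F_poly n lam y)`_k) x
    (- ((lam + 1) / 2%:R + k%:R) * (F_poly n lam x)`_k + mu_pairing n lam x * (E_poly n lam x)`_k).
Proof.
move=> x0; have d := is_derive_mulcR (- (-1) ^+ n) (is_derive_kern n lam k (or_introl erefl) x0).
have -> : - ((lam + 1) / 2%:R + k%:R) * (F_poly n lam x)`_k +
    mu_pairing n lam x * (E_poly n lam x)`_k =
   - (-1) ^+ n * (- 1 * (((lam + 1) / 2%:R + k%:R) * (kern n lam 1 x)`_k) -
      2%:R * kern_pairing n lam x * (kern n lam (- 1) x)`_k).
  by rewrite /E_poly /F_poly coefN coefZ /mu_pairing; ring.
by apply: is_derive_extR d => y; rewrite coefZ.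
Qed.

(** The sums of 2 c_j e^(kappa_j x) and of 2 d_j e^(- kappa_j x) are both read as
    values of a kernel at the opposite end point, hence as the pairing up to a factor. *)
Lemma diff_system_mu_pairing n lam : diff_system n lam (mu_pairing n lam).
Proof.
move=> x t /RltP x0; split.
- apply: (@is_derive_ext_loc R_AbsRing C_R_NormedModule
    (fun y => E_form n lam y (fun j => (E_poly n lam y)`_j.-1) (Ci * t)%C)).
    by apply: locally_pos => // y y0; rewrite E_fun_coef.
  rewrite E_fun_coef // F_fun_coef //.
  apply: (@is_deriveC_E_form n lam (fun y j => (E_poly n lam y)`_j.-1)).
    case=> [|j] [/ssrnat.leP j1 /ssrnat.leP jn] //.
    by rewrite kappaS; apply: is_derive_E_poly.
  have sE : (size (E_poly n lam x) <= n)%N by rewrite size_polyN size_poly.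
  rewrite sum_n_m_big RpowE RmultE.
  transitivity (2%:R * end_value 1 ((lam + 1) / 2%:R) x (E_poly n lam x)).
    rewrite (end_value_sum _ _ _ sE) big_distrr; apply: eq_bigr => j _.
    by rewrite kappaS IZR2E !RmultE mul1r.
  have -> : end_value 1 ((lam + 1) / 2%:R) x (E_poly n lam x) = - kern_pairing n lam x.
    rewrite -(kern_pairing_end n lam (or_introl erefl) x0) /end_value /E_poly hornerN.
    by rewrite mulrN.
  have -> : mu_pairing n lam x * (-1) ^+ n =
      - (2%:R * kern_pairing n lam x) * ((-1) ^+ n * (-1) ^+ n) by rewrite /mu_pairing; ring.
  by rewrite -expr2 sqrr_sign mulr1 mulrN.
- apply: (@is_derive_ext_loc R_AbsRing C_R_NormedModule
    (fun y => F_form n lam y (fun j => (F_poly n lam y)`_j.-1) (Ci * t)%C)).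
    by apply: locally_pos => // y y0; rewrite F_fun_coef.
  rewrite E_fun_coef // F_fun_coef //.
  apply: (@is_deriveC_F_form n lam (fun y j => (F_poly n lam y)`_j.-1)).
    case=> [|j] [/ssrnat.leP j1 /ssrnat.leP jn] //.
    by rewrite kappaS; apply: is_derive_F_poly.
  have sF : (size (F_poly n lam x) <= n)%N.
    by rewrite (leq_trans (size_scale_leq _ _)) // size_poly.
  rewrite sum_n_m_big.
  transitivity (2%:R * end_value (-1) ((lam + 1) / 2%:R) x (F_poly n lam x)).
    rewrite (end_value_sum _ _ _ sF) big_distrr; apply: eq_bigr => j _.
    by rewrite kappaS IZR2E !RmultE mulN1r.
  rewrite /mu_pairing -(kern_pairing_end n lam (or_intror erefl) x0) opprK.
  by rewrite /end_value /F_poly hornerZ; ring.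
Qed.

(** * Values at the end points through orthogonal polynomials *)

(** P is the orthogonal polynomial of degree n for the weight u^nu, normalized by
    P(0) = 1; Q is the kernel K(., 0), which is orthogonal of degree n - 1 for the
    weight u^(nu+1).  Writing P = 1 - X r turns orthogonality of P into the statement
    that r represents the moments of u^nu among those of u^(nu+1). *)
Record ortho_data n nu x (P Q r : {poly R}) : Prop := OrthoData {
  ortho_size : (size P <= n.+1)%N;
  ortho_P : forall q : {poly R}, (size q <= n)%N -> moment nu x (P * q) = 0;
  ortho_PE : P = 1 - 'X * r;
  ortho_Q : represents (moment nu x) n Q (horner_eval 0);
  ortho_r : represents (moment (nu + 1) x) n r (moment nu x) }.

Lemma ortho_exists n nu x : (0 < n)%N -> 0 < x -> exists P Q r, ortho_data n nu x P Q r.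
Proof.
move=> n0 x0.
pose r := riesz n (fun k => exp_moment (nu + 1 + 1 + k%:R) x)
  (fun k => exp_moment (nu + 1 + k%:R) x).
pose Q := riesz n (fun k => exp_moment (nu + 1 + k%:R) x) (fun k => (k == 0)%:R).
have rR : represents (moment (nu + 1) x) n r (moment nu x).
  apply: represents_ext (riesz_moment_represents n (nu + 1) _ x0) => q sq.
  by rewrite (moment_widen _ _ sq).
exists (1 - 'X * r), Q, r; split => //.
- by rewrite size_subr_leq ?size_poly1 // size_mulX_leq // size_poly.
- move=> q sq; have [_ rr] := rR.
  by rewrite mulrBl mul1r -mulrA linearB /= -moment_shift rr // subrr.
- apply: represents_ext (riesz_moment_represents n nu _ x0) => q sq.
  rewrite (bigD1 (Ordinal n0)) //= mulr1 big1 => [|k]; last first.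
    by rewrite -val_eqE /= => /negbTE ->; rewrite mulr0.
  by rewrite addr0 /horner_eval horner_coef0.
Qed.

Section Values.
Variables (n : nat) (nu x : R) (P Q r : {poly R}).
Hypotheses (n0 : (0 < n)%N) (x0 : 0 < x) (D : ortho_data n nu x P Q r).

Lemma ortho_P_at0 : P.[0] = 1.
Proof. by rewrite (ortho_PE D) !horner_rules mul0r subr0. Qed.

Lemma ortho_P_neq0 : P.[exp x] != 0 /\ P.[exp (- x)] != 0.
Proof.
apply: (ortho_horner_exp_neq0 x0 _ (ortho_size D) (ortho_P D)).
by apply: contra_eq_neq ortho_P_at0 => ->; rewrite horner0 eq_sym oner_eq0.
Qed.

Lemma ortho_Q_neq0 : Q.[exp x] != 0 /\ Q.[exp (- x)] != 0.
Proof.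
have [sQ rQ] := ortho_Q D.
apply: (@ortho_horner_exp_neq0 (nu + 1) x n.-1) => //.
- apply/eqP => Q0; have := rQ 1; rewrite size_poly1 Q0 mul0r linear0 /horner_eval => /(_ n0)/eqP.
  by rewrite hornerC eq_sym oner_eq0.
- by rewrite prednK.
move=> q sq; rewrite moment_shift mulrCA rQ.
  by rewrite /horner_eval !horner_rules mul0r.
by apply: leq_trans (size_mulX_leq sq) _; rewrite prednK.
Qed.

Lemma ortho_boundary :
  end_value 1 (nu + 1) x (P * Q) - end_value (- 1) (nu + 1) x (P * Q) = - n%:R.
Proof.
have [sQ rQ] := ortho_Q D.
apply: (@boundary_pairing _ (moment nu x)
  (fun p => end_value 1 (nu + 1) x p - end_value (- 1) (nu + 1) x p) n P Q (nu + 1)) => //.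
- by move=> p q; apply: linearD.
- by move=> p; rewrite moment_euler.
- exact: ortho_size D.
- exact: ortho_P_at0.
- exact: ortho_P D.
Qed.

(** The constant coefficient is the value at 0, which Q represents. *)
Lemma E_poly0 : (E_poly n nu x)`_0 = - end_value (- 1) ((nu + 1) / 2%:R) x Q.
Proof.
have [sQ rQ] := ortho_Q D; have [sK rK] := kern_represents n nu (-1) x0.
by rewrite /E_poly coefN -rK // mulrC rQ // /horner_eval horner_coef0.
Qed.

Lemma F_poly0 : (F_poly n nu x)`_0 = - (-1) ^+ n * end_value 1 ((nu + 1) / 2%:R) x Q.
Proof.
have [sQ rQ] := ortho_Q D; have [sK rK] := kern_represents n nu 1 x0.
by rewrite /F_poly coefZ -rK //; congr (_ * _); rewrite mulrC rQ // /horner_eval horner_coef0.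
Qed.

Lemma moment_kern_shift e :
  moment nu x (kern n (nu + 1) e x) = end_value e ((nu + 1 + 1) / 2%:R) x r.
Proof.
have [sr rr] := ortho_r D; have [sK rK] := kern_represents n (nu + 1) e x0.
by rewrite -rK // mulrC rr.
Qed.

(** (nu+2)/2 = nu/2 + 1: the extra factor e^(e x) is the X of P = 1 - X r. *)
Lemma end_value_P e :
  exp (e * (nu / 2%:R * x)) - end_value e ((nu + 1 + 1) / 2%:R) x r =
  exp (e * (nu / 2%:R * x)) * P.[exp (e * x)].
Proof.
rewrite (ortho_PE D) !horner_rules mulrBr mulr1; congr (_ - _).
rewrite /end_value [RHS]mulrA -expD; congr (exp _ * _); by field.
Qed.

(** At t = - nu/2 the sum defining E_(nu+1) is the moment, for u^nu, of a kernel of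
    the weight u^(nu+1); pairing that kernel with r evaluates r at the end point. *)
Lemma E_fun_at : E_fun n (nu + 1)%R x (- Ci * RtoC (nu / 2%:R)%R)%C =
  RtoC (exp (- (nu / 2%:R * x)) * P.[exp (- x)]).
Proof.
rewrite E_fun_coef // (@E_form_at _ _ _ _ (E_poly n (nu + 1) x)) //; last first.
  by rewrite size_polyN size_poly.
congr RtoC; have -> : nu / 2%:R + (nu + 1 + 1) / 2%:R - 1 = nu by field.
rewrite /E_poly linearN /= moment_kern_shift.
by have := end_value_P (-1); rewrite !mulN1r.
Qed.

Lemma F_fun_at : F_fun n (nu + 1)%R x (- Ci * RtoC (nu / 2%:R)%R)%C =
  RtoC ((-1) ^+ n * (exp (nu / 2%:R * x) * P.[exp x])).
Proof.
rewrite F_fun_coef // (@F_form_at _ _ _ _ (F_poly n (nu + 1) x)) //; last first.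
  by rewrite (leq_trans (size_scale_leq _ _)) // size_poly.
congr RtoC; have -> : nu / 2%:R + (nu + 1 + 1) / 2%:R - 1 = nu by field.
rewrite /F_poly linearZ /= moment_kern_shift mulNr -mulrBr; congr (_ * _).
by have := end_value_P 1; rewrite !mul1r.
Qed.

Lemma kern_normalized lam : represents (moment lam x) n
  (exp ((lam + 1) / 2%:R * x) *: kern n lam (- 1) x) (horner_eval (exp (- x))).
Proof.
have [sK rK] := kern_represents n lam (-1) x0.
split=> [|q sq]; first by rewrite (leq_trans (size_scale_leq _ _)).
rewrite -scalerAl linearZ /= rK // /end_value !mulN1r mulrA -expD subrr exp_0.
by rewrite mul1r.
Qed.

(** The normalized kernel of kern_normalized is K(., e^-x); here it is taken at the
    other end point. *)
Lemma kern_pairing_horner lam :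
  kern_pairing n lam x = (exp ((lam + 1) / 2%:R * x) *: kern n lam (- 1) x).[exp x].
Proof.
by rewrite -(kern_pairing_end n lam (or_introl erefl) x0) /end_value !mul1r hornerZ.
Qed.

Lemma kern_pairing_cd : (exp (- x) - exp x) * kern_pairing n nu x =
  exp (- x) * Q.[exp (- x)] * P.[exp x] - exp x * Q.[exp x] * P.[exp (- x)].
Proof.
rewrite kern_pairing_horner.
apply: (christoffel_darboux n0 (@moment_anisotropic nu x x0) (ortho_size D) (ortho_P D)
  (ortho_Q D) (kern_normalized nu) ortho_P_at0).
  by rewrite gt_eqF // exp_gt0.
by case: ortho_Q_neq0.
Qed.

Lemma kern_pairing_cd_shift : (exp (- x) - exp x) * kern_pairing n (nu + 1) x =
  Q.[exp (- x)] * P.[exp x] - Q.[exp x] * P.[exp (- x)].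
Proof.
rewrite kern_pairing_horner.
apply: (christoffel_darboux_shift (moment_shift nu x) n0 (@moment_anisotropic (nu + 1) x x0)
  (ortho_P D) (ortho_Q D) (kern_normalized (nu + 1)) (ortho_r D) (ortho_PE D)).
by case: ortho_P_neq0.
Qed.
End Values.

(** * The Riccati system *)

(** Two coefficients of the differential system agree wherever F does not vanish, and
    F_lam is a nonzero multiple of P(e^x) at t = - (lam - 1)/2. *)
Lemma mu_x_pairing n lam x : (0 < n)%N -> 0 < x -> mu_x n lam x = mu_pairing n lam x.
Proof.
move=> n0 x0; pose nu := lam - 1; have lamE : lam = nu + 1 by rewrite subrK.
have ds : diff_system n lam (mu_x n lam).
  apply: (epsilon_spec _ (diff_system n lam)); exists (mu_pairing n lam).
  exact: diff_system_mu_pairing.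
have [P [Q [r D]]] := @ortho_exists n nu x n0 x0.
have /RltP x0' := x0; pose s : R := nu / 2%:R.
have FE : F_fun n lam x (- Ci * RtoC s)%C = RtoC ((-1) ^+ n * (exp (s * x) * P.[exp x])).
  by rewrite {1}lamE; exact: F_fun_at x0 D.
have := is_deriveC_unique (proj1 (ds x (RtoC (Ropp s)) x0'))
  (proj1 (@diff_system_mu_pairing n lam x (RtoC (Ropp s)) x0')).
rewrite Ci_mul_opp FE.
apply: Cplus_mul_RtoC_inj; apply/eqP.
have [Pb _] := ortho_P_neq0 x0 D.
by rewrite !mulf_neq0 ?signr_eq0 // gt_eqF ?exp_gt0.
Qed.

Lemma is_derive_c_coef n lam x : (0 < n)%N -> 0 < x ->
  is_derive (fun y => c_coef n lam y 1) x
    ((lam + 1) / 2%:R * c_coef n lam x 1 + mu_pairing n lam x * d_coef n lam x 1).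
Proof.
move=> n0 x0; have := is_derive_E_poly n lam 0 x0.
rewrite addr0 !c_coefE ?d_coefE //.
apply: (@is_derive_ext_loc R_AbsRing R_NormedModule); apply: locally_pos => // y y0.
by rewrite c_coefE.
Qed.

Lemma is_derive_d_coef n lam x : (0 < n)%N -> 0 < x ->
  is_derive (fun y => d_coef n lam y 1) x
    (- ((lam + 1) / 2%:R) * d_coef n lam x 1 + mu_pairing n lam x * c_coef n lam x 1).
Proof.
move=> n0 x0; have := is_derive_F_poly n lam 0 x0.
rewrite addr0 !c_coefE ?d_coefE //.
apply: (@is_derive_ext_loc R_AbsRing R_NormedModule); apply: locally_pos => // y y0.
by rewrite d_coefE.
Qed.

Lemma endpoint_values n nu x : (0 < n)%N -> 0 < x ->
  exists Pa Pb Qa Qb : R,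
  [/\ Pb <> 0 /\ Qb <> 0,
      exp ((nu + 1) * x) * (Pb * Qb) - exp (- ((nu + 1) * x)) * (Pa * Qa) = - n%:R,
      (exp (- x) - exp x) * kern_pairing n nu x = exp (- x) * Qa * Pb - exp x * Qb * Pa /\
      (exp (- x) - exp x) * kern_pairing n (nu + 1) x = Qa * Pb - Qb * Pa,
      E_fun n (nu + 1)%R x (- Ci * RtoC (nu / 2%:R)%R)%C =
        RtoC (exp (- (nu / 2%:R * x)) * Pa)%R /\
      F_fun n (nu + 1)%R x (- Ci * RtoC (nu / 2%:R)%R)%C =
        RtoC ((-1) ^+ n * (exp (nu / 2%:R * x) * Pb))%R &
      c_coef n nu x 1 = - (exp (- ((nu + 1) / 2%:R * x)) * Qa) /\
      d_coef n nu x 1 = - (-1) ^+ n * (exp ((nu + 1) / 2%:R * x) * Qb)].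
Proof.
move=> n0 x0; have [P [Q [r D]]] := @ortho_exists n nu x n0 x0.
exists P.[exp (- x)], P.[exp x], Q.[exp (- x)], Q.[exp x]; split.
- by split; apply/eqP; [case: (ortho_P_neq0 x0 D) | case: (ortho_Q_neq0 n0 x0 D)].
- by have := ortho_boundary D; rewrite /end_value !mul1r !mulN1r !hornerM.
- by split; [exact: kern_pairing_cd n0 x0 D | exact: kern_pairing_cd_shift n0 x0 D].
- by split; [exact: E_fun_at x0 D | exact: F_fun_at x0 D].
rewrite c_coefE // d_coefE // (E_poly0 x0 D) (F_poly0 x0 D) /end_value.
by rewrite !mulN1r !mul1r.
Qed.

(* The usual reading of arithmetic on R and of the order on nat is restored. *)
Close Scope ring_scope.
Local Arguments exp x%_R_scope.
Bind Scope R_scope with R.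
Open Scope R_scope.
Local Infix "<=" := Peano.le : nat_scope.

Theorem theorem17 (n : nat) (nu a : R) (hn : (1 <= n)%nat) (ha : 0 < a < 1) :
  let Xa := X n nu a in
  let Ya := Y n nu a in
  mu n nu a = 2 * INR n * a / (1 - a ^ 2) * ((Xa + a * Ya) / (1 + a * Xa * Ya)) /\
  mu n (nu + 1) a =
    2 * INR n * a / (1 - a ^ 2) * ((a * Xa + Ya) / (1 + a * Xa * Ya)) /\
  (ex_derive (X n nu) a /\
   a * Derive (X n nu) a =
     nu * Xa - (1 - Xa ^ 2) *
       (2 * INR n * a / (1 - a ^ 2) * ((a * Xa + Ya) / (1 + a * Xa * Ya)))) /\
  (ex_derive (Y n nu) a /\
   a * Derive (Y n nu) a =
     - (nu + 1) * Ya + (1 - Ya ^ 2) *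
       (2 * INR n * a / (1 - a ^ 2) * ((Xa + a * Ya) / (1 + a * Xa * Ya)))).
Proof.
move=> Xa Ya; have [a0 a1] := ha.
have n0 : (0 < n)%N by apply/ssrnat.leP.
pose x := - ln a.
have x0' : 0 < x by have := ln_increasing a 1 a0 a1; rewrite ln_1 /x; lra.
have x0 : Order.lt (GRing.zero : R) x by apply/RltP.
have [Pa [Pb [Qa [Qb [[Pb0 Qb0] HN [H0 H1] [HE HF] [Hc Hd]]]]]] := @endpoint_values n nu x n0 x0.
have ea : exp (- x) = a by rewrite /x Ropp_involutive exp_ln.
have eb : exp x = / a by rewrite /x exp_Ropp exp_ln.
have an0 : a <> 0 by lra.
have ss : (-1) ^ n * (-1) ^ n = 1.
  rewrite -Rpow_mult_distr; have -> : -1 * -1 = 1 by lra.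
  exact: pow1.
have sE : (-1) ^ n = GRing.exp (GRing.opp (GRing.one R)) n by exact: RpowE.
pose w := exp ((nu + 1) * x).
have w0 : w <> 0 by apply: Rgt_not_eq; apply: exp_pos.
have N0 : INR n <> 0 by apply: not_0_INR => nE; move: n0; rewrite nE.
have gE : g n nu a = / exp (nu / 2 * x) * Pa.
  have HE' : E_fun n (nu + 1) x (- Ci * RtoC (nu / 2))%C = RtoC (exp (- (nu / 2 * x)) * Pa).
    exact: HE.
  by rewrite -exp_Ropp; exact: (f_equal Complex.Re HE').
have hE : h n nu a = (-1) ^ n * (exp (nu / 2 * x) * Pb).
  have HF' : F_fun n (nu + 1) x (- Ci * RtoC (nu / 2))%C =
      RtoC ((-1) ^ n * (exp (nu / 2 * x) * Pb)).
    by rewrite sE; exact: HF.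
  exact: (f_equal Complex.Re HF').
have cE' : c_coef n nu (- ln a) 1 = - (/ exp ((nu + 1) / 2 * x) * Qa).
  by rewrite -exp_Ropp; exact: Hc.
have dE' : d_coef n nu (- ln a) 1 = - (-1) ^ n * (exp ((nu + 1) / 2 * x) * Qb).
  by rewrite sE; exact: Hd.
have h0 : h n nu a <> 0.
  rewrite hE; apply: Rmult_integral_contrapositive_currified.
    by move=> s0; move: ss; rewrite s0; lra.
  by apply: Rmult_integral_contrapositive_currified => //; apply: Rgt_not_eq; apply: exp_pos.
have XE : Xa = (-1) ^ n * (/ w * / a) * Pa / Pb.
  rewrite /Xa /X gE hE; apply: X_value => //; first by apply: Rgt_not_eq; apply: exp_pos.
  rewrite /w -eb -!exp_plus; congr exp; lra.
have YE : Ya = - ((-1) ^ n * / w * Qa / Qb).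
  rewrite /Ya /Y cE' dE'.
  apply: Y_value => //; first by apply: Rgt_not_eq; apply: exp_pos.
  rewrite /w -!exp_plus; congr exp; lra.
have [muE mu1E] : - 2 * (-1) ^ n * kern_pairing n nu x =
      2 * INR n * a / (1 - a ^ 2) * ((Xa + a * Ya) / (1 + a * Xa * Ya)) /\
    - 2 * (-1) ^ n * kern_pairing n (nu + 1) x =
      2 * INR n * a / (1 - a ^ 2) * ((a * Xa + Ya) / (1 + a * Xa * Ya)).
  rewrite XE YE; apply: (@mu_from_XY a w ((-1) ^ n) (INR n) Pa Pb Qa Qb) => //.
  - by rewrite INRE -exp_Ropp; exact: HN.
  - by rewrite -eb -{1 2}ea; exact: H0.
  - by rewrite -eb -{1}ea; exact: H1.
have mkE lam : mu_x n lam x = - 2 * (-1) ^ n * kern_pairing n lam x.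
  have -> : mu_x n lam x = - (2 * (-1) ^ n * kern_pairing n lam x).
    by rewrite mu_x_pairing // sE IZR2E.
  lra.
have mE : mu n nu a = 2 * INR n * a / (1 - a ^ 2) * ((Xa + a * Ya) / (1 + a * Xa * Ya)).
  by rewrite -muE; exact: mkE.
have m1E : mu n (nu + 1) a = 2 * INR n * a / (1 - a ^ 2) * ((a * Xa + Ya) / (1 + a * Xa * Ya)).
  by rewrite -mu1E; exact: mkE.
have dX : is_derive (X n nu) a ((nu * Xa - mu n (nu + 1) a * (1 - Xa ^ 2)) / a).
  have := @diff_system_real n (nu + 1) _ x (nu / 2) (@diff_system_mu_pairing n (nu + 1)) x0'.
  rewrite -mu_x_pairing //; case=> dE dF.
  have hx0 : Complex.Re (F_fun n (nu + 1) (- ln a) (- Ci * RtoC (nu / 2))%C) <> 0 := h0.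
  have := is_derive_quotient_riccati a0 dE dF hx0.
  by have -> : 2 * (nu / 2) = nu by lra.
have dY : is_derive (Y n nu) a ((- (nu + 1) * Ya + mu n nu a * (1 - Ya ^ 2)) / a).
  have dc := is_derive_c_coef nu n0 x0; have dd := is_derive_d_coef nu n0 x0.
  have d0 : d_coef n nu (- ln a) 1 <> 0.
    rewrite dE'; apply: Rmult_integral_contrapositive_currified.
      by move=> s0; move: ss; rewrite -[X in X * X]Ropp_involutive s0; lra.
    by apply: Rmult_integral_contrapositive_currified => //; apply: Rgt_not_eq; apply: exp_pos.
  have mk : mu_x n nu x = mu_pairing n nu x by exact: mu_x_pairing.
  have dc' : is_derive (fun y => c_coef n nu y 1) (- ln a)
      (- - ((nu + 1) / 2) * c_coef n nu (- ln a) 1 + mu_x n nu x * d_coef n nu (- ln a) 1).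
    by rewrite Ropp_involutive mk; exact: dc.
  have dd' : is_derive (fun y => d_coef n nu y 1) (- ln a)
      (- ((nu + 1) / 2) * d_coef n nu (- ln a) 1 + mu_x n nu x * c_coef n nu (- ln a) 1).
    by rewrite mk; exact: dd.
  have := is_derive_opp _ _ _ (is_derive_quotient_riccati a0 dc' dd' d0).
  congr is_derive; rewrite /Hierarchy.opp /= /mu -/x /Ya /Y -/x.
  move: (c_coef n nu x 1 / d_coef n nu x 1) (mu_x n nu x) => W m.
  rewrite -Rdiv_opp_l; congr (_ / _); lra.
have aK z : a * (z / a) = z by rewrite /Rdiv Rmult_comm Rmult_assoc Rinv_l // Rmult_1_r.
rewrite -mE -m1E; split=> //; split=> //; split; split.
- by eexists; exact: dX.
- by rewrite (is_derive_unique _ _ _ dX) aK; lra.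
- by eexists; exact: dY.
- by rewrite (is_derive_unique _ _ _ dY) aK; lra.
Qed.
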